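(* Let $N\ge 1$, and let $(u,v)$ be a solution (with no sign assumption on $u,v$) of $$\begin{cases}-\Delta u=u-u^3-3uv^2 & \text{in }\mathbb{R}^N\\ -\Delta v=v-v^3-3u^2v & \text{in }\mathbb{R}^N,\end{cases}$$ such that $$u(x',x_N)\to 1,\quad v(x',x_N)\to 0\quad\text{as }x_N\to+\infty,\qquad u(x',x_N)\to 0,\quad v(x',x_N)\to 1\quad\text{as }x_N\to-\infty,$$ uniformly with respect to $x'\in\mathbb{R}^{N-1}$. Then there exists $\alpha\in\mathbb{R}$ such that $$u(x)=\frac{1+\tanh\big(\frac{x_N+\alpha}{\sqrt2}\big)}{2},\qquad v(x)=\frac{1-\tanh\big(\frac{x_N+\alpha}{\sqrt2}\big)}{2}\qquad\text{for all }x\in\mathbb{R}^N;$$ that is, $u$ and $v$ are $1$-dimensional and monotone, and the solution is unique and explicit, up to translations.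
   Context: Points of $\mathbb{R}^N$ are written $x=(x',x_N)\in\mathbb{R}^{N-1}\times\mathbb{R}$. A solution is a pair $(u,v)\in L^3_{loc}(\mathbb{R}^N)\times L^3_{loc}(\mathbb{R}^N)$ of real-valued functions solving the system in the sense of distributions. Such solutions are smooth (up to modification on a null set), and pointwise conditions refer to the smooth representatives. *)

(* Defs.v *)
From HB Require Import structures.
From mathcomp Require Import all_boot all_order all_algebra.
From mathcomp Require Import all_classical all_reals all_analysis.

Set Implicit Arguments.
Unset Strict Implicit.
Unset Printing Implicit Defensive.

Import Order.TTheory GRing.Theory Num.Theory.
Import numFieldNormedType.Exports.

Local Open Scope classical_set_scope.
Local Open Scope ring_scope.

(* Product of the Borel sigma-algebras of the coordinates (as the library does
   for [n.-tuple T]); it is the Borel sigma-algebra of R^n. *)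
Definition measure_rV_display : measure_display.
Proof. exact: default_measure_display. Qed.

Section measurable_rV.
Context {R : realType} (n : nat).

Let coor : 'I_n -> 'rV[R]_n -> measurableTypeR R := fun i x => x ord0 i.

Let rV_set0 : g_sigma_preimage coor set0.
Proof. exact: sigma_algebra0. Qed.

Let rV_setC A : g_sigma_preimage coor A -> g_sigma_preimage coor (~` A).
Proof. exact: sigma_algebraC. Qed.

Let rV_bigcup (F : (set 'rV[R]_n)^nat) :
  (forall i, g_sigma_preimage coor (F i)) ->
  g_sigma_preimage coor (\bigcup_i (F i)).
Proof. exact: sigma_algebra_bigcup. Qed.

HB.instance Definition _ := @isMeasurable.Build measure_rV_display
  'rV[R]_n (g_sigma_preimage coor) rV_set0 rV_setC rV_bigcup.

Lemma measurable_coor (i : 'I_n) :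
  measurable_fun [set: 'rV[R]_n] (fun x => x ord0 i : measurableTypeR R).
Proof.
move=> _ Y mY; rewrite setTI; apply: sub_sigma_algebra => /=.
rewrite -bigcup_seq/=; exists i => /=; first by rewrite mem_index_enum.
by exists Y => //; rewrite setTI.
Qed.

Lemma measurable_fun_rVP d (T : measurableType d) (f : T -> 'rV[R]_n) :
  (forall i, measurable_fun setT (fun t => f t ord0 i : measurableTypeR R)) ->
  measurable_fun setT f.
Proof.
move=> mf; apply: (@measurability _ _ _ _ _ _
  (\big[setU/set0]_(i < n) preimage_set_system setT (coor i) measurable)) => //.
move=> _ [B + <-]; rewrite -bigcup_seq/= => -[i _ [C mC <-]].
by rewrite !setTI -comp_preimage -[X in measurable X]setTI; exact: mf.
Qed.

End measurable_rV.

Section lebesgue_rV.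
Context {R : realType}.

Definition cons_rV n (x : measurableTypeR R * 'rV[R]_n) : 'rV[R]_n.+1 :=
  row_mx (const_mx x.1 : 'rV[R]_1) x.2.

Definition uncons_rV n (x : 'rV[R]_n.+1) : measurableTypeR R * 'rV[R]_n :=
  (x ord0 ord0, @rsubmx R 1 1 n x).

Lemma cons_rVK n : cancel (@cons_rV n) (@uncons_rV n).
Proof.
move=> [a x]; rewrite /uncons_rV /cons_rV /=; congr pair.
  transitivity (row_mx (const_mx a : 'rV[R]_1) x ord0 (lshift n ord0)).
    by congr (row_mx _ _ _ _); exact/val_inj.
  by rewrite row_mxEl mxE.
by rewrite row_mxKr.
Qed.

Lemma measurable_cons_rV n : measurable_fun setT (@cons_rV n).
Proof.
apply: measurable_fun_rVP => i; rewrite /cons_rV.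
case: (@splitP 1 n i) => j ij.
  rewrite (_ : (fun t => _) = fst) //; apply/funext => t.
  have -> : i = lshift n j by exact/val_inj.
  by apply: etrans (row_mxEl _ _ _ _) _; rewrite mxE.
rewrite (_ : (fun t => _) = (fun x : 'rV[R]_n => x ord0 j) \o snd).
  by apply: measurableT_comp; [exact: measurable_coor|exact: measurable_snd].
apply/funext => t; have -> : i = rshift 1 j by exact/val_inj.
exact: row_mxEr.
Qed.

Lemma measurable_uncons_rV n : measurable_fun setT (@uncons_rV n).
Proof.
apply/measurable_fun_pairP; split; first exact: measurable_coor.
apply: measurable_fun_rVP => i /=.
rewrite (_ : (fun t => _) =
    (fun x : 'rV[R]_n.+1 => x ord0 (@rshift 1 n i))).
  exact: measurable_coor.
by apply/funext => t; rewrite /= mxE.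
Qed.

Section step.
Variables (n : nat) (m : {sigma_finite_measure set 'rV[R]_n -> \bar R}).

Definition lebesgue_rV_step : set 'rV[R]_n.+1 -> \bar R :=
  pushforward (@lebesgue_measure R \x m)%E (@cons_rV n).

Let step0 : lebesgue_rV_step set0 = 0%E.
Proof. by rewrite /lebesgue_rV_step /pushforward preimage_set0 measure0. Qed.

Let step_ge0 A : (0 <= lebesgue_rV_step A)%E.
Proof. by rewrite /lebesgue_rV_step /pushforward; apply: measure_ge0. Qed.

Let step_sigma_additive : semi_sigma_additive lebesgue_rV_step.
Proof.
move=> F mF tF mUF; rewrite /lebesgue_rV_step /pushforward preimage_bigcup.
apply: measure_semi_sigma_additive.
- by move=> k; rewrite -[X in measurable X]setTI; exact: measurable_cons_rV.
- apply/trivIsetP => /= i j _ _ ij; rewrite -preimage_setI.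
  by move/trivIsetP : tF => /(_ _ _ _ _ ij) ->//; rewrite preimage_set0.
- by rewrite -preimage_bigcup -[X in measurable X]setTI; exact: measurable_cons_rV.
Qed.

HB.instance Definition _ := isMeasure.Build _ _ _ lebesgue_rV_step
  step0 step_ge0 step_sigma_additive.

Let step_sigma_finite : sigma_finite setT lebesgue_rV_step.
Proof.
have [F FT mF] : sigma_finite setT (@lebesgue_measure R \x m)%E.
  have /sigma_finiteP[F [TF ndF Foo]] := sigma_finiteT (@lebesgue_measure R).
  have /sigma_finiteP[G [TG ndG Goo]] := sigma_finiteT m.
  exists (fun k => F k `*` G k).
    rewrite -setXTT TF TG predeqE => -[x y]; split.
      move=> [/= [i _ Fix] [j _ Gjy]]; exists (maxn i j) => //; split.
      - by move: x Fix; exact/subsetPset/ndF/leq_maxl.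
      - by move: y Gjy; exact/subsetPset/ndG/leq_maxr.
    by move=> [i _ []/= ? ?]; split; exists i.
  move=> k; have [? ?] := Foo k; have [? ?] := Goo k.
  split; first exact: measurableX.
  by rewrite product_measure1E// lte_mul_pinfty// ge0_fin_numE.
exists (fun k => @uncons_rV n @^-1` F k).
  by rewrite -preimage_bigcup -FT preimage_setT.
move=> k; have [mFk Fk] := mF k; split.
  by rewrite -[X in measurable X]setTI; exact: measurable_uncons_rV.
rewrite /lebesgue_rV_step /pushforward -comp_preimage.
by rewrite (_ : _ \o _ = id) //; apply/funext => x /=; rewrite cons_rVK.
Qed.

HB.instance Definition _ := Measure_isSigmaFinite.Build _ _ _ lebesgue_rV_step
  step_sigma_finite.

End step.

(* Lebesgue measure on R^n: the unit mass on R^0, then the product with the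
   one-dimensional Lebesgue measure, transported by R * R^n -> R^(n+1). *)
Fixpoint lebesgue_rV (n : nat) : {sigma_finite_measure set 'rV[R]_n -> \bar R} :=
  match n with
  | 0 => dirac (0 : 'rV[R]_0)
  | n'.+1 => lebesgue_rV_step (lebesgue_rV n')
  end.

End lebesgue_rV.
Arguments lebesgue_rV : clear implicits.

Section distributional_solutions.
Context {R : realType} {n : nat}.
Implicit Types (f u v phi : 'rV[R]_n -> R) (x : 'rV[R]_n).

Definition partial (i : 'I_n) f x : R := 'D_(delta_mx ord0 i) f x.

Definition laplacian f x : R := \sum_(i < n) partial i (partial i f) x.

Fixpoint C_ (k : nat) f : Prop :=
  match k with
  | 0 => continuous f
  | k'.+1 => continuous f /\
      forall i, (forall x, derivable f x (delta_mx ord0 i)) /\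
                C_ k' (partial i f)
  end.

Definition smooth f := forall k, C_ k f.

Definition test_function phi :=
  smooth phi /\ compact (closure [set x | phi x != 0]).

(* L^p_loc(R^n); elements are given by Borel representatives. *)
Definition Lp_loc (p : nat) f :=
  measurable_fun setT f /\
  forall K : set 'rV[R]_n, compact K ->
    (\int[lebesgue_rV R n]_(x in K) (`|f x| ^+ p)%:E < +oo)%E.

(* - Delta u = g in the sense of distributions *)
Definition neg_laplacian_distr u (g : 'rV[R]_n -> R) :=
  forall phi, test_function phi ->
    (\int[lebesgue_rV R n]_x (u x * - laplacian phi x)%:E =
     \int[lebesgue_rV R n]_x (g x * phi x)%:E)%E.

Definition solution u v :=
  [/\ Lp_loc 3 u, Lp_loc 3 v,
      neg_laplacian_distr u (fun x => u x - u x ^+ 3 - 3 * u x * v x ^+ 2) &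
      neg_laplacian_distr v (fun x => v x - v x ^+ 3 - 3 * u x ^+ 2 * v x)].

Definition smooth_representative u (U : 'rV[R]_n -> R) :=
  smooth U /\ {ae lebesgue_rV R n, forall x, u x = U x}.

End distributional_solutions.

(* f(x', x_N) --> l as x_N --> F, uniformly in x'; here N = n.+1 and x_N is the
   coordinate of index ord_max. *)
Definition cvg_last_uniformly (R : realType) (n : nat) (f : 'rV[R]_n.+1 -> R)
    (F : set_system R) (l : R) :=
  forall e : R, 0 < e ->
    \forall t \near F, forall x : 'rV[R]_n.+1,
      x ord0 ord_max = t -> `|f x - l| < e.

Definition tanh (R : realType) (x : R) : R :=
  (expR x - expR (- x)) / (expR x + expR (- x)).

(* Main.v *)
Require Import Defs.
From HB Require Import structures.
From mathcomp Require Import all_boot all_order all_algebra.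
From mathcomp Require Import all_classical all_reals all_analysis.
From mathcomp Require Import measurable_realfun ring lra.

Set Implicit Arguments.
Unset Strict Implicit.
Unset Printing Implicit Defensive.

Import Order.TTheory GRing.Theory Num.Theory.
Import numFieldNormedType.Exports.

Local Open Scope classical_set_scope.
Local Open Scope ring_scope.

(* Adding and subtracting the two equations, w = U + V and z = U - V both solve
   the Allen-Cahn equation Delta f = f^3 - f; w tends to 1 at both ends and z
   tends to 1 and -1. A Keller-Osserman bound gives |w|, |z| <= 1, and a
   reflection argument makes them Lipschitz. In the sliding method, the usual
   passage to a limit of translates is replaced by a quantitative strong maximum
   principle: if a >= b are two solutions and a - b is small at a point, it is
   small on a large ball around it. Sliding z below w in the direction x_N gives
   w >= z(. + t e_N) for all t, hence w = 1; sliding z below itself in any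
   direction nu with nu_N > 0 shows that z is nondecreasing along nu, so that z
   only depends on x_N and solves y'' = y^3 - y, whose first integral gives
   tanh. The pointwise equations for U and V follow from the distributional ones
   by Fubini and smooth bump functions. *)

(** * Second order calculus on row vectors *)

(** The coefficient 3 of the coupling is what decouples the system: the cubic terms then add up to
    [(U + V)^3] and [(U - V)^3]. The obstacle is the unbounded domain: suprema over [x'] need not be
    attained. Where a supremum must be attained, a small multiple of [sqdist q], whose Laplacian is
    constant, is subtracted, and the error is absorbed by a definite gap in the inequality to be
    contradicted; or the auxiliary function is cut off by a power of [r - sqdist q]. Uniformity in
    [x'] comes from constants that depend only on the dimension, on the bound 1 and on the Lipschitz
    constant, never on the solution or the point. The threshold 3/4, which recurs everywhere,
    exceeds [1 / sqrt 3]: beyond it [t^3 - t] increases with a definite slope, so two solutions with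
    values in the same well can be compared without information at infinity. *)

Section directional_derivatives.
Context {R : realType} {W : normedModType R}.
Implicit Types (f g : W -> R) (p v : W).

Lemma is_derive_line f p v (t d : R) :
  is_derive (t *: v + p) v f d <-> is_derive t 1 (fun s => f (s *: v + p)) d.
Proof.
have E : (fun h : R => h^-1 *: ((f \o shift (t *: v + p)) (h *: v) - f (t *: v + p))) =
  (fun h : R => h^-1 *: (((fun s => f (s *: v + p)) \o shift t) (h *: 1) - f (t *: v + p))).
  apply/funext => h; rewrite /= /shift /=.
  by rewrite [h *: 1]mulr1 scalerDl addrA.
split=> -[]; rewrite /derivable /derive => h1 h2; split;
  rewrite /derivable /derive.
- by rewrite -E.
- by rewrite -E.
- by rewrite E.
- by rewrite E.
Qed.

Lemma is_derive_continuous1 (f : R -> R) (t d : R) :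
  is_derive t 1 f d -> {for t, continuous f}.
Proof. by case=> /derivable1_diffP/differentiable_continuous. Qed.

(** Everything happens on the line through [p] directed by [v]. If [d] were positive, [g] would be
    positive just after [p], and the mean value theorem would push [f] above its maximum. *)
Lemma second_derivative_test f g p v (d : R) :
  (forall x, is_derive x v f (g x)) -> is_derive p v g d ->
  (\forall x \near p, f x <= f p) -> g p = 0 /\ d <= 0.
Proof.
move=> fg gd fmax.
pose F t := f (t *: v + p); pose G t := g (t *: v + p).
have FG (t : R) : is_derive t (1:R) F (G t) by apply/is_derive_line; exact: fg.
have Gd : is_derive (0:R) (1:R) G d.
  by apply/is_derive_line; rewrite scale0r add0r.
have G0 : G 0 = g p by rewrite /G scale0r add0r.
have F0 : F 0 = f p by rewrite /F scale0r add0r.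
have [r r0 Fr] : exists2 r, 0 < r & forall t, `|t| < r -> F t <= F 0.
  have : \forall t \near (0:R), f (t *: v + p) <= f p.
    have : (fun t : R => t *: v + p) @ 0 --> p.
      rewrite -[X in _ --> X]add0r -(scale0r v).
      by apply: cvgD; [apply: cvgZr_tmp; exact: cvg_id|exact: cvg_cst].
    by move=> /(_ _ fmax).
  move=> /nbhs_ballP[r /= r0 H]; exists r => // t tr.
  by rewrite F0; apply: H; rewrite /ball/= sub0r normrN.
have G00 : G 0 = 0.
  have [|t _|||_ D0] := @derive1_at_max _ F (-r) r 0.
  - lra.
  - by have [] := FG t.
  - by rewrite in_itv/=; lra.
  - by move=> t; rewrite in_itv/= => tr; apply: Fr; rewrite ltr_norml.
  by have [_ E] := FG 0; rewrite -E.
split; first by rewrite -G0.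
rewrite leNgt; apply/negP => d0.
have : (fun h : R => h^-1 *: ((G \o shift 0) (h *: 1) - G 0)) @ 0^' --> d.
  by case: Gd => + <-.
move=> /cvgrPdist_lt/(_ _ d0).
rewrite near_withinE => /nbhs_ballP[s /= s0 Hs].
have Gpos t : 0 < t -> t < s -> 0 < G t.
  move=> t0 ts; have := Hs t; rewrite /ball/= sub0r normrN gtr0_norm//.
  move=> /(_ ts); rewrite gt_eqF// => /(_ isT).
  rewrite /shift/= addr0 [t *: 1]mulr1 G00 subr0 => H.
  have : 0 < t^-1 * G t.
    by move: H; rewrite ltr_norml => /andP[_]; rewrite gtrBl.
  by rewrite pmulr_rgt0 ?invr_gt0.
pose m := Num.min (r/2) (s/2).
have m0 : 0 < m by rewrite lt_min; apply/andP; split; lra.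
have [mr ms] : m < r /\ m < s.
  by rewrite !gt_min; split; apply/orP; [left|right]; lra.
have [|c] := @MVT R F G 0 m m0 (fun x _ => FG x).
  by apply: derivable_within_continuous => x _; have [] := FG x.
rewrite in_itv/= => /andP[c0 cm] E.
have : F m <= F 0 by apply: Fr; rewrite gtr0_norm.
suff : 0 < F m - F 0 by lra.
by rewrite E; apply: mulr_gt0; [apply: Gpos => //; lra|lra].
Qed.

End directional_derivatives.

(** * Algebra of functions of class [C^k], defined by iterated partial derivatives *)

Section Ck_functions.
Context {R : realType} {n : nat}.
Implicit Types (f g : 'rV[R]_n -> R) (x : 'rV[R]_n) (k : nat) (i j : 'I_n).

Lemma C_continuous k f : C_ k f -> continuous f.
Proof. by case: k => [//|k] []. Qed.

Lemma C_partial k f i : C_ k.+1 f -> C_ k (partial i f).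
Proof. by case=> _ /(_ i)[]. Qed.

Lemma C_is_derive k f i x :
  C_ k.+1 f -> is_derive x (delta_mx ord0 i) f (partial i f x).
Proof. by case=> _ /(_ i)[+ _] => /(_ x); exact: derivableP. Qed.

Lemma C_SW k f : C_ k.+1 f -> C_ k f.
Proof.
elim: k f => [f []//|k ih f [cf df]]; split=> // i.
by have [dfi Cfi] := df i; split => //; exact: ih.
Qed.

Lemma partial_eq f g i : (forall x, is_derive x (delta_mx ord0 i) f (g x)) ->
  partial i f = g.
Proof. by move=> fg; apply/funext => x; have [_] := fg x. Qed.

Lemma C_intro k f (g : 'I_n -> 'rV[R]_n -> R) : continuous f ->
  (forall i x, is_derive x (delta_mx ord0 i) f (g i x)) ->
  (forall i, C_ k (g i)) -> C_ k.+1 f.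
Proof.
move=> cf fg Cg; split=> // i; split; first by move=> x; have [] := fg i x.
by rewrite (partial_eq (fg i)).
Qed.

Lemma partial_cst (c : R) i : partial i (fun _ : 'rV[R]_n => c) = fun=> 0.
Proof. exact: partial_eq. Qed.

Lemma C_cst k (c : R) : C_ k (fun _ : 'rV[R]_n => c).
Proof.
elim: k c => [c|k ih c]; first exact: cst_continuous.
apply: (@C_intro _ _ (fun _ _ => 0)).
- exact: cst_continuous.
- by move=> i; exact: ih.
Qed.

Lemma partialD k f g i : C_ k.+1 f -> C_ k.+1 g ->
  partial i (fun x => f x + g x) = fun x => partial i f x + partial i g x.
Proof.
move=> Cf Cg; apply: partial_eq => x.
have ? := C_is_derive i x Cf; have ? := C_is_derive i x Cg.
exact: is_deriveD.
Qed.

Lemma partialM k f g i : C_ k.+1 f -> C_ k.+1 g ->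
  partial i (fun x => f x * g x) =
  fun x => f x * partial i g x + g x * partial i f x.
Proof.
move=> Cf Cg; apply: partial_eq => x.
have ? := C_is_derive i x Cf; have ? := C_is_derive i x Cg.
exact: is_deriveM.
Qed.

Lemma C_D k f g : C_ k f -> C_ k g -> C_ k (fun x => f x + g x).
Proof.
elim: k f g => [f g cf cg x|k ih f g Cf Cg].
  by apply: continuousD; [exact: cf|exact: cg].
apply: (@C_intro _ _ (fun i x => partial i f x + partial i g x)) => [x|i x|i].
- by apply: continuousD; apply: (@C_continuous k.+1).
- have ? := C_is_derive i x Cf; have ? := C_is_derive i x Cg.
  exact: is_deriveD.
- by apply: ih; exact: C_partial.
Qed.

Lemma C_M k f g : C_ k f -> C_ k g -> C_ k (fun x => f x * g x).
Proof.
elim: k f g => [f g cf cg x|k ih f g Cf Cg].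
  by apply: continuousM; [exact: cf|exact: cg].
apply: (@C_intro _ _ (fun i x => f x * partial i g x + g x * partial i f x))
  => [x|i x|i].
- by apply: continuousM; apply: (@C_continuous k.+1).
- have ? := C_is_derive i x Cf; have ? := C_is_derive i x Cg.
  exact: is_deriveM.
- by apply: C_D; apply: ih; (exact: C_partial || exact: C_SW).
Qed.

Lemma C_N k f : C_ k f -> C_ k (fun x => - f x).
Proof.
move=> Cf; rewrite (_ : (fun x => _) = (fun x => -1 * f x)).
  by apply: C_M => //; exact: C_cst.
by apply/funext => x; rewrite mulN1r.
Qed.

Lemma C_X k f m : C_ k f -> C_ k (fun x => f x ^+ m).
Proof.
move=> Cf; elim: m => [|m ih]; first exact: C_cst.
rewrite (_ : (fun x => _) = (fun x => f x * f x ^+ m)); first exact: C_M.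
by apply/funext => x; rewrite exprS.
Qed.

Lemma C_sum k (I : Type) (s : seq I) (f : I -> 'rV[R]_n -> R) :
  (forall a, C_ k (f a)) -> C_ k (fun x => \sum_(a <- s) f a x).
Proof.
move=> Cf; elim: s => [|a s ih].
  rewrite (_ : (fun x => _) = (fun=> 0)); first exact: C_cst.
  by apply/funext => x; rewrite big_nil.
rewrite (_ : (fun x => _) = (fun x => f a x + \sum_(b <- s) f b x)).
  exact: C_D.
by apply/funext => x; rewrite big_cons.
Qed.

Lemma C_prod k (I : Type) (s : seq I) (f : I -> 'rV[R]_n -> R) :
  (forall a, C_ k (f a)) -> C_ k (fun x => \prod_(a <- s) f a x).
Proof.
move=> Cf; elim: s => [|a s ih].
  rewrite (_ : (fun x => _) = (fun=> 1)); first exact: C_cst.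
  by apply/funext => x; rewrite big_nil.
rewrite (_ : (fun x => _) = (fun x => f a x * \prod_(b <- s) f b x)).
  exact: C_M.
by apply/funext => x; rewrite big_cons.
Qed.

Lemma is_derive_coord i x v : is_derive x v (fun x : 'rV[R]_n => x ord0 i) (v ord0 i).
Proof.
have E : (fun h : R => h^-1 *: (((fun x : 'rV[R]_n => x ord0 i) \o shift x) (h *: v) - x ord0 i))
   @ 0^' --> v ord0 i.
  apply: (@cvg_trans _ (cst (v ord0 i) @ 0^')); last exact: cvg_cst.
  apply: near_eq_cvg.
  near=> h.
  have h0 : h != 0 by near: h; exact: nbhs_dnbhs_neq.
  by rewrite /= /shift !mxE addrK [_ *: _]mulrA mulVf// mul1r.
by split; [exact: (cvgP _ E)|exact: (cvg_lim _ E)].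
Unshelve. all: by end_near. Qed.

Lemma C_coord k i : C_ k (fun x : 'rV[R]_n => x ord0 i).
Proof.
have cc : continuous (fun x : 'rV[R]_n => x ord0 i) by exact: coord_continuous.
case: k => [//|k].
apply: (@C_intro _ _ (fun j _ => (delta_mx ord0 j : 'rV[R]_n) ord0 i)) => //.
  by move=> j x; exact: is_derive_coord.
by move=> j; exact: C_cst.
Qed.

Lemma is_derive_comp k f (psi : R -> R) x i d : C_ k.+1 f ->
  is_derive (f x) 1 psi d ->
  is_derive x (delta_mx ord0 i) (fun y => psi (f y)) (d * partial i f x).
Proof.
move=> Cf psid; pose e : 'rV[R]_n := delta_mx ord0 i.
have E : 0 *: e + x = x by rewrite scale0r add0r.
have H : is_derive (0 : R) (1 : R) (fun s => f (s *: e + x)) (partial i f x).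
  by apply: (is_derive_line f x e 0 _).1; rewrite E; exact: (C_is_derive i x Cf).
rewrite -[x in is_derive x]E; apply: (is_derive_line _ x e 0 _).2.
have psid' : is_derive (f (0 *: e + x)) (1 : R) psi d by rewrite E.
exact: is_derive1_comp psid' H.
Qed.

End Ck_functions.

Lemma rV_continuous (R : realType) n (T : topologicalType) (g : T -> 'rV[R]_n) :
  (forall i, continuous (fun t => g t ord0 i)) -> continuous g.
Proof.
move=> cg t; apply/cvg_ballP => e e0.
have H : forall i : 'I_n, \forall s \near t, ball (g t ord0 i) e (g s ord0 i).
  by move=> i; move: (cg i t) => /cvg_ballP; apply.
apply: (filterS _ (filter_forall _ H)) => s Hs.
by split => // i j; rewrite ord1; exact: Hs.
Qed.

(** * Symmetries of the Laplacian *)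

Section diagonal_affine_maps.
Context {R : realType} {n : nat}.
Implicit Types (f g : 'rV[R]_n -> R) (x s c : 'rV[R]_n) (k : nat) (i j : 'I_n).

(** One family for the two symmetries in use: [s = 1] gives translations, and a single entry -1 in
    [s] gives the reflection in a coordinate hyperplane. *)
Definition diag_affine s c x : 'rV[R]_n := \row_j (s ord0 j * x ord0 j + c ord0 j).

Lemma diag_affine_continuous s c : continuous (diag_affine s c).
Proof.
apply: rV_continuous => j.
rewrite (_ : (fun t => _) = (fun x : 'rV[R]_n => s ord0 j * x ord0 j + c ord0 j)).
  apply: (@C_D _ _ 0); last exact: (@C_cst _ _ 0).
  by apply: (@C_M _ _ 0); [exact: (@C_cst _ _ 0)|exact: (@C_coord _ _ 0)].
by apply/funext => y; rewrite mxE.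
Qed.

Lemma is_derive_diag_affine f s c x i d :
  is_derive (diag_affine s c x) (delta_mx ord0 i) f d ->
  is_derive x (delta_mx ord0 i) (fun y => f (diag_affine s c y)) (s ord0 i * d).
Proof.
set e := delta_mx ord0 i => fd.
have E y : 0 *: e + y = y by rewrite scale0r add0r.
rewrite -[x in is_derive x]E; apply: (is_derive_line _ x e 0 _).2.
rewrite (_ : (fun t => _) =
   (fun t : R => f (t *: e + diag_affine s c x)) \o (fun t => s ord0 i * t)).
  rewrite mulrC.
  apply: (@is_derive1_comp _ (fun t : R => f (t *: e + diag_affine s c x))).
    by rewrite mulr0; apply: (is_derive_line f _ e 0 _).1; rewrite E.
  have := @is_deriveZ R R^o R^o id (s ord0 i) 0 1 1 _.
  by rewrite [s ord0 i *: 1]mulr1; apply.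
apply/funext => t /=; congr f; apply/rowP => j; rewrite !mxE eqxx /=.
case: eqVneq => [->|_]; last by rewrite !mulr0 !add0r.
by rewrite !mulr1; ring.
Qed.

Lemma C_diag_affine k f s c : C_ k f -> C_ k (fun x => f (diag_affine s c x)).
Proof.
elim: k f => [f cf|k ih f Cf].
  by move=> x; apply: continuous_comp; [exact: diag_affine_continuous|exact: cf].
apply: (@C_intro _ _ _ _ (fun i x => s ord0 i * partial i f (diag_affine s c x)))
  => [x|i x|i].
- apply: continuous_comp; first exact: diag_affine_continuous.
  exact: (C_continuous Cf).
- by apply: is_derive_diag_affine; exact: (C_is_derive _ _ Cf).
- by apply: C_M; [exact: C_cst|apply: ih; exact: C_partial].
Qed.

Lemma partial_diag_affine k f s c i : C_ k.+1 f ->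
  partial i (fun x => f (diag_affine s c x)) =
  fun x => s ord0 i * partial i f (diag_affine s c x).
Proof.
move=> Cf; apply: partial_eq => x.
by apply: is_derive_diag_affine; exact: (C_is_derive _ _ Cf).
Qed.

Lemma laplacian_diag_affine f s c x : C_ 2 f ->
  (forall i, s ord0 i ^+ 2 = 1) ->
  laplacian (fun x => f (diag_affine s c x)) x = laplacian f (diag_affine s c x).
Proof.
move=> Cf s1; apply: eq_bigr => i _.
rewrite (partial_diag_affine _ _ _ Cf) (partialM _ (k := 0)).
- rewrite partial_cst mulr0 addr0 (partial_diag_affine _ _ _ (C_partial i Cf)).
  by rewrite mulrA -expr2 s1 mul1r.
- exact: C_cst.
- by apply: C_diag_affine; exact: C_partial.
Qed.

End diagonal_affine_maps.

(** * Laplacians of products, powers and squared distances; interior maxima *)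

Section laplacian_theory.
Context {R : realType} {n : nat}.
Implicit Types (f g : 'rV[R]_n -> R) (x p : 'rV[R]_n) (i j : 'I_n).

Lemma laplacianD f g x : C_ 2 f -> C_ 2 g ->
  laplacian (fun x => f x + g x) x = laplacian f x + laplacian g x.
Proof.
move=> Cf Cg; rewrite /laplacian -big_split; apply: eq_bigr => i _ /=.
by rewrite (partialD _ Cf Cg) (partialD _ (C_partial i Cf) (C_partial i Cg)).
Qed.

Lemma laplacianM f g x : C_ 2 f -> C_ 2 g ->
  laplacian (fun x => f x * g x) x = f x * laplacian g x + g x * laplacian f x
    + 2 * \sum_(i < n) partial i f x * partial i g x.
Proof.
move=> Cf Cg; rewrite /laplacian !mulr_sumr -!big_split; apply: eq_bigr => i _ /=.
have [Cf' Cg'] := (C_partial i Cf, C_partial i Cg).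
have [Cf1 Cg1] := (C_SW Cf, C_SW Cg).
rewrite (partialM _ Cf Cg) (partialD _ (C_M Cf1 Cg') (C_M Cg1 Cf')).
rewrite (partialM _ Cf1 Cg') (partialM _ Cg1 Cf').
move: (f x) (g x) (partial i f x) (partial i g x).
by move: (partial i (partial i f) x) (partial i (partial i g) x) => *; ring.
Qed.

Lemma laplacian_cst (c : R) x : laplacian (fun _ : 'rV[R]_n => c) x = 0.
Proof. by apply: big1 => i _; rewrite !partial_cst. Qed.

Lemma laplacianZ c f x : C_ 2 f -> laplacian (fun x => c * f x) x = c * laplacian f x.
Proof.
move=> Cf; rewrite (laplacianM _ _ Cf); last exact: C_cst.
rewrite laplacian_cst mulr0 addr0 big1 ?mulr0 ?addr0// => i _.
by rewrite partial_cst mul0r.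
Qed.

Lemma laplacianN f x : C_ 2 f -> laplacian (fun x => - f x) x = - laplacian f x.
Proof.
move=> Cf.
have -> : (fun x => - f x) = (fun x => -1 * f x).
  by apply/funext => y; rewrite mulN1r.
by rewrite (laplacianZ _ _ Cf) mulN1r.
Qed.

Lemma laplacianB f g x : C_ 2 f -> C_ 2 g ->
  laplacian (fun x => f x - g x) x = laplacian f x - laplacian g x.
Proof. by move=> Cf Cg; rewrite (laplacianD _ Cf (C_N Cg)) laplacianN. Qed.

Lemma partialX k f m i : C_ k.+1 f ->
  partial i (fun x => f x ^+ m.+1) = fun x => m.+1%:R * f x ^+ m * partial i f x.
Proof.
move=> Cf; apply: partial_eq => x.
have ? := C_is_derive i x Cf.
have -> : (fun x => f x ^+ m.+1) = f ^+ m.+1 by apply/funext => y; rewrite exprfctE.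
by apply: is_derive_eq.
Qed.

Lemma laplacianX f m x : C_ 2 f ->
  laplacian (fun x => f x ^+ m.+2) x = m.+2%:R * f x ^+ m.+1 * laplacian f x +
    (m.+2 * m.+1)%:R * f x ^+ m * \sum_(i < n) partial i f x ^+ 2.
Proof.
move=> Cf; rewrite /laplacian !mulr_sumr -big_split; apply: eq_bigr => i _ /=.
have Cf1 := C_SW Cf; have Cf' := C_partial i Cf.
rewrite (partialX _ _ Cf) (partialM _ (C_M (C_cst _ _) (C_X _ Cf1)) Cf').
rewrite (partialM _ (C_cst _ _) (C_X _ Cf1)) partial_cst (partialX _ _ Cf1).
rewrite natrM; move: (f x) (partial i f x) (partial i (partial i f) x) => *; ring.
Qed.

(** The squared Euclidean distance: the norm of row vectors is the sup norm, which is not smooth. *)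
Definition sqdist p x : R := \sum_(i < n) (x ord0 i - p ord0 i) ^+ 2.

Lemma C_sqdist k p : C_ k (sqdist p).
Proof.
apply: C_sum => i; apply: C_X; apply: C_D; first exact: C_coord.
exact: C_cst.
Qed.

Lemma partial_sum (I : Type) (s : seq I) (F : I -> 'rV[R]_n -> R) i :
  (forall a, C_ 1 (F a)) ->
  partial i (fun x => \sum_(a <- s) F a x) = fun x => \sum_(a <- s) partial i (F a) x.
Proof.
move=> CF; elim: s => [|a s ih].
  have -> : (fun x => \sum_(a <- [::]) F a x) = fun=> 0.
    by apply/funext => x; rewrite big_nil.
  by rewrite partial_cst; apply/funext => x; rewrite big_nil.
have -> : (fun x => \sum_(b <- a :: s) F b x) = fun x => F a x + \sum_(b <- s) F b x.
  by apply/funext => x; rewrite big_cons.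
rewrite (partialD _ (CF a) (C_sum s CF)) ih.
by apply/funext => x; rewrite big_cons.
Qed.

Lemma partial_coord i j :
  partial i (fun x : 'rV[R]_n => x ord0 j) = fun=> (j == i)%:R.
Proof.
apply: partial_eq => x; have := is_derive_coord j x (delta_mx ord0 i).
by rewrite mxE eqxx.
Qed.

Lemma partial_sqdist p i : partial i (sqdist p) = fun x => 2 * (x ord0 i - p ord0 i).
Proof.
have CF j : C_ 1 (fun x : 'rV[R]_n => x ord0 j - p ord0 j).
  by apply: C_D; [exact: C_coord|exact: C_cst].
rewrite partial_sum; last by move=> j; exact: C_X.
apply/funext => x; rewrite (bigD1 i)//= big1 => [|j /negPf ji].
  rewrite addr0 (partialX _ _ (CF i)) (partialD _ (C_coord 1 _) (C_cst 1 _)).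
  by rewrite partial_coord partial_cst eqxx addr0 mulr1 expr1.
rewrite (partialX _ _ (CF j)) (partialD _ (C_coord 1 _) (C_cst 1 _)).
by rewrite partial_coord partial_cst ji addr0 mulr0.
Qed.

Lemma laplacian_sqdist p x : laplacian (sqdist p) x = 2 * n%:R.
Proof.
rewrite /laplacian (eq_bigr (fun=> 2)) => [|i _].
  by rewrite sumr_const card_ord mulr_natr.
rewrite partial_sqdist (partialM _ (k := 0)); last 2 first.
- exact: C_cst.
- by apply: C_D; [exact: C_coord|exact: C_cst].
rewrite partial_cst mulr0 addr0 (partialD _ (C_coord 1 _) (C_cst 1 _)).
by rewrite partial_coord partial_cst eqxx addr0 mulr1.
Qed.

Lemma sum_partial_sqdist p x :
  \sum_(i < n) partial i (sqdist p) x ^+ 2 = 4 * sqdist p x.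
Proof.
by rewrite mulr_sumr; apply: eq_bigr => i _; rewrite partial_sqdist; ring.
Qed.

Lemma sqdist_ge0 p x : 0 <= sqdist p x.
Proof. by apply: sumr_ge0 => i _; exact: sqr_ge0. Qed.

Lemma sqdistxx p : sqdist p p = 0.
Proof. by apply: big1 => i _; rewrite subrr expr0n. Qed.

Lemma sqdist_ball_compact p (r : R) : compact [set x | sqdist p x <= r].
Proof.
apply: bounded_closed_compact.
  exists (`|p| + (1 + r)); split; first exact: num_real.
  move=> M MM x /= xr; apply/ltW/(le_lt_trans _ MM).
  rewrite -[x in `|x|](subrK p) addrC (le_trans (ler_normD _ _))// lerD2l.
  have r0 : 0 <= r := le_trans (sqdist_ge0 _ _) xr.
  rewrite [leLHS]/Num.norm /= mx_normrE; apply/bigmax_leP; split; first by lra.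
  move=> [i j] _ /=; rewrite !mxE (ord1 i).
  have : (x ord0 j - p ord0 j) ^+ 2 <= r.
    apply: le_trans xr; rewrite /sqdist (bigD1 j)//= lerDl.
    by apply: sumr_ge0 => ? _; exact: sqr_ge0.
  set a := _ - _; move=> ar; rewrite ler_norml; nra.
apply: (@preimage_closed _ _ (sqdist p) [set y | y <= r]); last exact: closed_le.
by move=> x _; apply: (C_continuous (C_sqdist 0 p)).
Qed.

(** The maximum of [f] over [K] lies in the superlevel set of [f q], which the last hypothesis keeps
    away from the boundary. Each use provides a point [q] where [f] is positive and a function [f]
    that is nonpositive, or below [f q], on the boundary. *)
Lemma max_principle f (K : set 'rV[R]_n) q : C_ 2 f -> compact K -> K q ->
  (forall x, K x -> f q <= f x -> K^° x) ->
  exists p, [/\ K p, f q <= f p, forall i, partial i f p = 0 & laplacian f p <= 0].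
Proof.
move=> Cf cK Kq Kint.
have cf : {within K, continuous f}.
  by apply: continuous_subspaceT; exact: (C_continuous Cf).
have [p pK maxp] := EVT_max_rV (ex_intro _ q Kq) cK cf.
have {}pK : K p by rewrite inE in pK.
have qp : f q <= f p by apply: maxp; rewrite inE.
have near_p : \forall x \near p, f x <= f p.
  by have := Kint _ pK qp; apply: filterS => x Kx; apply: maxp; rewrite inE.
have H i : partial i f p = 0 /\ partial i (partial i f) p <= 0.
  have := @second_derivative_test _ _ f (partial i f) p (delta_mx ord0 i).
  apply; last exact: near_p.
    by move=> x; exact: (C_is_derive i x Cf).
  exact: (C_is_derive i p (C_partial i Cf)).
exists p; split => //; first by move=> i; have [] := H i.
by apply: sumr_le0 => i _; have [] := H i.
Qed.

End laplacian_theory.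

(** * Solutions of the Allen-Cahn equation *)

Definition allen_cahn (R : realType) (n : nat) (u : 'rV[R]_n -> R) :=
  C_ 2 u /\ forall x, laplacian u x = u x ^+ 3 - u x.

(* The inequality obtained at an interior maximum of [(r - |y - x|^2) * (u y - 1)];
   letting [r] tend to infinity yields [u x <= 1]. *)
Lemma keller_osserman_ineq (R : realFieldType) (N r v P A s : R) :
  0 <= N -> 0 < r -> 0 < v -> 0 < P -> 0 < A -> 0 <= s -> P = r - s ->
  P * (P * ((A + 1) ^+ 3 - (A + 1)) + A * - (2 * N)) + 2 * - (4 * A * s) <= 0 ->
  r * v <= P * A -> r * v ^+ 2 <= 2 * N + 8.
Proof.
move=> N0 r0 v0 P0 A0 s0 Ps H HA.
(* Of [(A + 1)^3 - (A + 1) = A^3 + 3 A^2 + 2 A] only the cube is kept; [P] and [s] are bounded by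
   [r]. The terms [2 N] and [4 s] are the Laplacian and the squared gradient of the squared
   distance. *)
have H1 : A * (P * A) ^+ 2 <= A * ((2 * N + 8) * r).
  have Pn : P * N <= r * N by rewrite ler_wpM2r//; lra.
  have PA : 0 <= P ^+ 2 * (3 * A ^+ 2 + 2 * A).
    by rewrite mulr_ge0// ?addr_ge0// ?mulr_ge0 ?sqr_ge0// ltW.
  have : A * (2 * (P * N) + 8 * s) <= A * ((2 * N + 8) * r).
    by rewrite ler_pM2l//; lra.
  apply: le_trans.
  have -> : A * (2 * (P * N) + 8 * s) = P * (A * (2 * N)) + 2 * (4 * A * s) by ring.
  have -> : A * (P * A) ^+ 2 =
    P * (P * ((A + 1) ^+ 3 - (A + 1))) - P ^+ 2 * (3 * A ^+ 2 + 2 * A) by ring.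
  lra.
rewrite ler_pM2l// in H1.
have : (r * v) ^+ 2 <= (2 * N + 8) * r.
  by apply: le_trans H1; rewrite ler_pXn2r// nnegrE; apply: ltW => //; exact: mulr_gt0.
have -> : (r * v) ^+ 2 = (r * v ^+ 2) * r by ring.
by rewrite ler_pM2r.
Qed.

(** Within a well, [t^2 + t s + s^2 - 1] is at least [27/16 - 1 = 11/16], which exceeds [1/2]. *)
Lemma double_well_gap (R : realFieldType) (k s t : R) : 0 < k -> k <= t - s ->
  (3/4 <= s /\ 3/4 <= t) \/ (s <= - (3/4) /\ t <= - (3/4)) ->
  k / 2 < t ^+ 3 - t - (s ^+ 3 - s).
Proof.
move=> k0 kst st.
suff : (t - s) * (11/16) <= t ^+ 3 - t - (s ^+ 3 - s) by lra.
have -> : t ^+ 3 - t - (s ^+ 3 - s) = (t - s) * (t ^+ 2 + t * s + s ^+ 2 - 1) by ring.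
rewrite ler_pM2l; last by lra.
case: st => -[s1 t1].
  have : 0 <= (t - 3/4) * (s - 3/4) by rewrite mulr_ge0; lra.
  nra.
have : 0 <= (- t - 3/4) * (- s - 3/4) by rewrite mulr_ge0; lra.
nra.
Qed.

Section allen_cahn_theory.
Context {R : realType} {n : nat}.
Implicit Types (a b u : 'rV[R]_n -> R) (x y p q : 'rV[R]_n) (i j : 'I_n).

Lemma near_C_lt (f : 'rV[R]_n -> R) (c : R) k x : C_ k f -> f x < c -> \forall y \near x, f y < c.
Proof. by move=> Cf fxc; exact: (cvgr_lt _ (@C_continuous _ _ _ _ Cf x)). Qed.

Lemma near_C_gt (f : 'rV[R]_n -> R) (c : R) k x : C_ k f -> c < f x -> \forall y \near x, c < f y.
Proof. by move=> Cf fxc; exact: (cvgr_gt _ (@C_continuous _ _ _ _ Cf x)). Qed.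

Lemma closed_C_le (f : 'rV[R]_n -> R) (c : R) k : C_ k f -> closed [set x | f x <= c].
Proof.
move=> Cf; apply: (@preimage_closed _ _ f [set y | y <= c]); last exact: closed_le.
by move=> x _; exact: (@C_continuous _ _ _ _ Cf).
Qed.

Lemma allen_cahnN u : allen_cahn u -> allen_cahn (fun x => - u x).
Proof.
move=> [Cu Eu]; split; first exact: C_N.
by move=> x; rewrite laplacianN// Eu; ring.
Qed.

Lemma allen_cahn_le1 u x : allen_cahn u -> u x <= 1.
Proof.
move=> [Cu Eu]; rewrite leNgt; apply/negP => ux.
pose v y := u y - 1.
have Cv k : (k <= 2)%N -> C_ k v.
  move=> k2; apply: C_D; last exact: C_cst.
  case: k k2 => [|[|[|//]]] _ //; last exact: C_SW.
  exact/C_SW/C_SW.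
have vx : 0 < v x by rewrite subr_gt0.
(* Just large enough to violate [keller_osserman_ineq]; the [+ 1] makes the violation strict. *)
pose r := (2 * n%:R + 8) / v x ^+ 2 + 1.
have n0 : 0 <= n%:R :> R := ler0n _ _.
have vx2 : 0 < v x ^+ 2 by rewrite exprn_gt0.
have r0 : 0 < r.
  by rewrite addr_gt0// divr_gt0//; lra.
have rv : 2 * n%:R + 8 < r * v x ^+ 2.
  by rewrite /r [_ * v x ^+ 2]mulrDl mul1r divfK ?gt_eqF// ltrDl.
pose rho y := r + - sqdist x y.
have Crho k : C_ k rho by apply: C_D; [exact: C_cst|exact/C_N/C_sqdist].
pose f y := rho y * v y.
have fx : f x = r * v x by rewrite /f /rho sqdistxx oppr0 addr0.
have rvx : 0 < r * v x by apply: mulr_gt0.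
have [||z Kz fxz|p [Kp fxp grad0 lapf]] :=
    @max_principle _ _ f _ x _ (@sqdist_ball_compact _ _ x r).
- exact: (C_M (Crho 2) (Cv 2 isT)).
- by rewrite /= sqdistxx ltW.
- have : 0 < rho z.
    have : 0 <= rho z by rewrite subr_ge0.
    rewrite le0r => /orP[/eqP rho0|//].
    by move: fxz; rewrite fx /f rho0 mul0r => H; lra.
  rewrite subr_gt0 => /(near_C_lt (C_sqdist 0 x)).
  by apply: filterS => t /= /ltW.
move: lapf; rewrite (laplacianM _ (Crho 2) (Cv 2 isT)).
have E : laplacian v p = u p ^+ 3 - u p.
  rewrite (laplacianB _ Cu (C_cst 2 _)) laplacian_cst subr0; exact: Eu.
have Erho : laplacian rho p = - (2 * n%:R).
  rewrite (laplacianB _ (C_cst 2 _) (C_sqdist 2 _)) laplacian_cst sub0r.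
  by rewrite laplacian_sqdist.
have prho i : partial i rho p = - partial i (sqdist x) p.
  have -> : rho = fun y => r + -1 * sqdist x y.
    by apply/funext => y; rewrite mulN1r.
  rewrite (partialD _ (C_cst 1 _) (C_M (C_cst 1 _) (C_sqdist 1 _))).
  rewrite (partialM _ (C_cst 1 _) (C_sqdist 1 _)) !partial_cst.
  by rewrite add0r mulr0 addr0 mulN1r.
have rhop : 0 <= rho p by rewrite subr_ge0.
have vp : 0 < rho p * v p by move: fxp; rewrite fx => /(lt_le_trans rvx).
have {}rhop : 0 < rho p.
  by move: rhop; rewrite le0r => /orP[/eqP H|//]; move: vp; rewrite H mul0r ltxx.
have {}vp : 0 < v p by move: vp; rewrite pmulr_rgt0.
have pv i : rho p * partial i v p = v p * partial i (sqdist x) p.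
  have := grad0 i; rewrite (partialM _ (Crho 1) (Cv 1 isT)) prho => H.
  by apply/eqP; rewrite -subr_eq0 -H; apply/eqP; ring.
(* Since the gradient of [rho * v] vanishes at [p], that of [v] can be eliminated at the cost of a
   factor [rho p], which is why the whole inequality is multiplied by [rho p] below. *)
have S : rho p * \sum_(i < n) partial i rho p * partial i v p = - (4 * v p * sqdist x p).
  rewrite mulr_sumr (eq_bigr (fun i => - v p * partial i (sqdist x) p ^+ 2)).
    by rewrite -mulr_sumr sum_partial_sqdist; ring.
  move=> i _; rewrite mulrCA pv prho.
  by move: (partial i (sqdist x) p) (v p) => *; ring.
have u_v : u p = v p + 1 by rewrite /v subrK.
have sp : 0 <= sqdist x p := sqdist_ge0 _ _.
have rho_s : rho p = r - sqdist x p by [].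
rewrite E Erho u_v => lapf.
have : rho p * (rho p * ((v p + 1) ^+ 3 - (v p + 1)) + v p * - (2 * n%:R) +
   2 * \sum_(i < n) partial i rho p * partial i v p) <= 0 by rewrite pmulr_rle0.
rewrite mulrDr [rho p * (2 * _)]mulrCA S => H.
rewrite fx in fxp.
by have := keller_osserman_ineq n0 r0 vx rhop vp sp rho_s H fxp; rewrite leNgt rv.
Qed.

Lemma allen_cahn_bounded u x : allen_cahn u -> -1 <= u x <= 1.
Proof.
move=> Au; rewrite allen_cahn_le1// andbT.
by have := allen_cahn_le1 x (allen_cahnN Au); lra.
Qed.

(** Where [b] exceeds [a], both values lie in one well, so [b - a] has a Laplacian bounded below by
    a multiple of itself; this is incompatible with an almost maximum of [b - a]. Nothing is assumed
    at infinity in any direction. *)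
Lemma allen_cahn_comparison a b : allen_cahn a -> allen_cahn b ->
  (forall x, a x < b x -> (3/4 <= a x /\ 3/4 <= b x) \/ (a x <= - (3/4) /\ b x <= -(3/4))) ->
  forall x, b x <= a x.
Proof.
move=> Aa Ab near1 q; rewrite leNgt; apply/negP => abq.
have [[Ca Ea] [Cb Eb]] := (Aa, Ab).
pose k := b q - a q; have k0 : 0 < k by rewrite subr_gt0.
(* The penalty then has Laplacian [2 n e <= k / 2], below the gap given by [double_well_gap]; [n.+1]
   avoids a division by zero. *)
pose e := k / (4 * n.+1%:R).
have n0 : 0 < n.+1%:R :> R by rewrite ltr0n.
have e0 : 0 < e by rewrite divr_gt0// mulr_gt0.
(* The penalisation makes the supremum of [b - a] attained. *)
pose f x := b x - a x - e * sqdist q x.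
have Cab := C_D Cb (C_N Ca); have Ce := C_M (C_cst 2 e) (C_sqdist 2 q).
have Cf : C_ 2 f := C_D Cab (C_N Ce).
have fq : f q = k by rewrite /f sqdistxx mulr0 subr0.
have sub2 x : b x - a x <= 2.
  have := allen_cahn_bounded x Ab; have := allen_cahn_bounded x Aa.
  by move: (a x) (b x) => s t; clear; lra.
have [|z Kz fqz|p [_ fqp _ lapf]] :=
    @max_principle _ _ f _ q Cf (@sqdist_ball_compact _ _ q (2 / e)).
- by rewrite /= sqdistxx divr_ge0// ltW.
- have : sqdist q z < 2 / e.
    rewrite ltr_pdivlMr//; have := sub2 z; move: fqz; rewrite fq /f.
    by move: (b z - a z) => t; clear -k0; lra.
  move=> /(near_C_lt (C_sqdist 0 q)).
  by apply: filterS => t /= /ltW.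
move: lapf; rewrite (laplacianB _ Cab Ce) (laplacianB _ Cb Ca) Ea Eb.
rewrite (laplacianZ _ _ (C_sqdist 2 q)) laplacian_sqdist.
have kp : k <= b p - a p.
  move: fqp; rewrite fq /f.
  have : 0 <= e * sqdist q p by rewrite mulr_ge0 ?sqdist_ge0// ltW.
  by move: (b p - a p) (e * sqdist q p) => s t; clear; lra.
have En : e * (2 * n%:R) <= k / 2.
  have -> : k / 2 = e * (2 * n.+1%:R).
    by rewrite /e; field; rewrite -natr1 in n0 *; rewrite gt_eqF.
  by rewrite ler_pM2l// ler_pM2l// ler_nat.
have abp : a p < b p by rewrite -subr_gt0 (lt_le_trans k0).
have := near1 p abp.
move=> st; rewrite leNgt subr_gt0.
by rewrite (le_lt_trans En)//; exact: double_well_gap kp st.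
Qed.

(* Let [S] be the distance to the mirror of the reflection exchanging [x] and
   [x + 2 s e_i]; for [0 <= S <= 1] the odd part of [u] lies below the barrier
   [4 S - 2 S^2]. *)
Lemma allen_cahn_lipschitz_pos u x i (s : R) : allen_cahn u -> 0 <= s ->
  u (x + (2 * s) *: delta_mx ord0 i) - u x <= 4 * s.
Proof.
move=> Au s0; have ub y := allen_cahn_bounded y Au.
have [s1|s1] := leP s 1; last first.
  have := ub x; have := ub (x + (2 * s) *: delta_mx ord0 i).
  by move: (u x) (u _) s1 => t t'; clear; lra.
set e := delta_mx ord0 i; pose m := x + s *: e.
have ei j : (s *: e) ord0 j = s * (j == i)%:R by rewrite !mxE eqxx.
pose sg : 'rV[R]_n := \row_j (if j == i then -1 else 1).
pose c : 'rV[R]_n := \row_j (if j == i then 2 * m ord0 i else 0).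
have sg1 j : sg ord0 j ^+ 2 = 1 by rewrite mxE; case: ifP => _; rewrite ?sqrrN expr1n.
pose q := m + s *: e.
have Eq : q = x + (2 * s) *: e.
  by rewrite /q /m -addrA -scalerDl; congr (_ + _ *: _); clear; ring.
have Rq : diag_affine sg c q = x.
  apply/rowP => j; rewrite /q /m /e !mxE !eqxx /=.
  by case: eqVneq => [->|_]; rewrite /= ?mulr1 ?mulr0; clear; ring.
have [Cu Eu] := Au.
(* The penalty must be small twice: [d <= 1] leaves [f q] positive thanks to the slack [2 s^2] of
   the barrier, and [2 n d <= 2] leaves the Laplacian of [f] positive. *)
pose d := (n.+1%:R : R)^-1.
have d0 : 0 < d by rewrite invr_gt0 ltr0n.
pose S y := y ord0 i - m ord0 i.
have CS k : C_ k S by apply: (C_D (C_coord _ _) (C_cst _ _)).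
pose V y := u y - u (diag_affine sg c y).
have Cr := C_diag_affine sg c Cu.
have CV : C_ 2 V := C_D Cu (C_N Cr).
pose B y := 4 * S y - 2 * S y ^+ 2.
have CB1 : C_ 2 (fun y => 4 * S y) := C_M (C_cst 2 _) (CS 2).
have CB2 : C_ 2 (fun y => 2 * S y ^+ 2) := C_M (C_cst 2 _) (C_X 2 (CS 2)).
have CB : C_ 2 B := C_D CB1 (C_N CB2).
have Cd := C_M (C_cst 2 d) (C_sqdist 2 m).
pose f y := V y - B y - d * sqdist m y.
have CVB : C_ 2 (fun y => V y - B y) := C_D CV (C_N CB).
have Cf : C_ 2 f := C_D CVB (C_N Cd).
have fE y : f y = V y - B y - d * sqdist m y by [].
have Sq : S q = s by rewrite /S !mxE !eqxx /= mulr1; clear; ring.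
have sq : sqdist m q = s ^+ 2.
  rewrite /sqdist (bigD1 i)//= big1 => [|j ji].
    by rewrite addr0 -/(S q) Sq.
  by rewrite !mxE (negPf ji) andbF mulr0 addr0 subrr expr0n.
rewrite leNgt -Eq; apply/negP => Vq.
have fq0 : 0 < f q.
  have d1 : d <= 1 by rewrite invf_le1 ?ltr0n// ler1n.
  have dsq : d * s ^+ 2 <= s ^+ 2 by rewrite ler_piMl ?sqr_ge0.
  have s2 := sqr_ge0 s.
  rewrite fE /B Sq sq /V Rq; move: Vq dsq s2.
  by move: (u q - u x) (d * s ^+ 2) (s ^+ 2) => t t' t''; clear; lra.
have V2 y : V y <= 2.
  have := ub y; have := ub (diag_affine sg c y).
  by rewrite /V; move: (u y) (u _) => t t'; clear; lra.
(* [f] is nonpositive on the boundary: on the mirror [S = 0] the reflection fixes the point, so [V]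
   and [B] vanish; on [S = 1] one has [B = 2 >= V]; on the sphere the penalty equals 2. *)
pose K := [set y | sqdist m y <= 2 / d] `&` ([set y | 0 <= S y] `&` [set y | S y <= 1]).
have cK : compact K.
  apply: compact_closedI; first exact: sqdist_ball_compact.
  apply: closedI; last exact: (@closed_C_le S 1 0%N (CS 0)).
  by have := @closed_C_le _ 0 0%N (C_N (CS 0)); under eq_set do rewrite oppr_le0.
have fz0 z : K z -> 0 < f z -> sqdist m z < 2 / d /\ 0 < S z /\ S z < 1.
  move=> [_ [/= S0 S1]] fz; split; last split.
  - rewrite ltr_pdivlMr// mulrC; have := V2 z; move: fz; rewrite fE /B.
    move: S0 S1; move: (S z) (V z) (d * sqdist m z) => t v w; clear => t0 t1.
    have : 0 <= t * (1 - t) by rewrite mulr_ge0; lra.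
    by lra.
  - rewrite lt_neqAle S0 andbT eq_sym; apply/eqP => Sz.
    have Rz : diag_affine sg c z = z.
      apply/rowP => j; rewrite [LHS]mxE [sg _ _]mxE [c _ _]mxE.
      case: eqVneq => [->|_]; last by rewrite mul1r addr0.
      by move: Sz; rewrite /S; move: (z _ _) (m _ _) => t v; clear; lra.
    have := mulr_ge0 (ltW d0) (sqdist_ge0 m z).
    by move: fz; rewrite fE /B Sz /V Rz; move: (d * _) (u z) => t v; clear; lra.
  - rewrite lt_neqAle S1 andbT; apply/eqP => Sz.
    have := mulr_ge0 (ltW d0) (sqdist_ge0 m z); have := V2 z.
    by move: fz; rewrite fE /B Sz; move: (d * _) (V z) => t v; clear; lra.
have [|z Kz fqz|p [_ fqp _ lapf]] := @max_principle _ _ f _ q Cf cK.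
- split; rewrite /= ?Sq// sq ler_pdivlMr//.
  have : d <= 1 by rewrite invf_le1 ?ltr0n// ler1n.
  by move: s0 s1 d0; clear; nra.
- have [z1 [z2 z3]] := fz0 z Kz (lt_le_trans fq0 fqz).
  have H1 := near_C_lt (C_sqdist 0 m) z1.
  have H2 := near_C_lt (CS 0) z3.
  have H3 := near_C_gt (CS 0) z2.
  by near=> y; split; [|split]; apply: ltW; near: y.
have lapS y : laplacian S y = 0.
  rewrite (laplacianB _ (C_coord 2 _) (C_cst 2 _)) laplacian_cst subr0.
  by apply: big1 => j _; rewrite partial_coord partial_cst.
have pS j : partial j S = fun=> (i == j)%:R.
  rewrite (partialD _ (C_coord 1 _) (C_cst 1 _)) partial_coord partial_cst.
  by apply/funext => y; rewrite addr0.
have lapB : laplacian B p = - 4.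
  rewrite (laplacianB _ CB1 CB2) (laplacianZ _ _ (CS 2)) lapS mulr0 sub0r.
  rewrite (laplacianZ _ _ (C_X 2 (CS 2))) (laplacianX _ _ (CS 2)) lapS mulr0 add0r.
  rewrite (bigD1 i)//= big1 => [|j /negPf ji].
    by rewrite pS eqxx expr0 mulr1 expr1n addr0 !mulr1 -natrM.
  by rewrite pS eq_sym ji expr0n.
have En : d * (2 * n%:R) <= 2.
  by rewrite mulrCA ger_pMr// mulrC ler_pdivrMr ?ltr0n// mul1r ler_nat.
move: lapf; rewrite (laplacianB _ CVB Cd) (laplacianB _ CV CB) (laplacianB _ Cu Cr) lapB.
rewrite (laplacian_diag_affine _ _ Cu sg1) !Eu (laplacianZ _ _ (C_sqdist 2 m)) laplacian_sqdist.
move: En (ub p) (ub (diag_affine sg c p)).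
move: (u p) (u _) (d * _) => t t' w; clear => w2 tb tb'.
(* So the Laplacian of [V] is at least -1, [- B] contributes 4 and the penalty costs at most 2: the
   sum is at least 1, against [lapf]. *)
have W (r : R) : -1 <= r <= 1 -> - (1/2) <= r ^+ 3 - r <= 1/2.
  move=> /andP[r1 r2].
  have : 0 <= (r + 1) * (r - 1/2) ^+ 2 by rewrite mulr_ge0 ?sqr_ge0//; lra.
  have : 0 <= (1 - r) * (r + 1/2) ^+ 2 by rewrite mulr_ge0 ?sqr_ge0//; lra.
  by move=> *; apply/andP; split; lra.
move=> lapf; have /andP[] := W _ tb; have /andP[] := W _ tb'. lra.
Unshelve. all: by end_near. Qed.

End allen_cahn_theory.

(** The first term is the Laplacian of [k * rho^(m + 2)] for [rho = Q - |z - y|^2], with [P = rho]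
    and [s = |z - y|^2]. Away from the centre ([s > d]) its squared gradient term grows like [m^2],
    the other one like [m]; a large exponent thus beats the zero-order term, whose slope is at most
    2 on [[-1, 1]]. *)
Lemma strong_max_ineq (R : realFieldType) (k P s N Q d A B : R) (m : nat) :
  0 < k -> 0 < P -> P <= Q -> d < s -> 0 <= d -> 0 <= N ->
  Q ^+ 2 + 2 * N * Q < m%:R * (4 * d) -> A - B < k * P ^+ m.+2 -> B <= A ->
  -1 <= A <= 1 -> -1 <= B <= 1 ->
  0 < k * (m.+2%:R * P ^+ m.+1 * - (2 * N) + (m.+2 * m.+1)%:R * P ^+ m * (4 * s)) -
    (A ^+ 3 - A - (B ^+ 3 - B)).
Proof.
move=> k0 P0 PQ ds d0 N0 Hm ABk BA /andP[A1 A2] /andP[B1 B2].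
have AB : A ^+ 3 - A - (B ^+ 3 - B) <= 2 * (A - B).
  have -> : A ^+ 3 - A - (B ^+ 3 - B) = (A ^+ 2 + A * B + B ^+ 2 - 1) * (A - B) by ring.
  rewrite ler_wpM2r ?subr_ge0//.
  have : 0 <= (1 - A) * (1 + A) by rewrite mulr_ge0; lra.
  have : 0 <= (1 - B) * (1 + B) by rewrite mulr_ge0; lra.
  have : 0 <= (A - B) ^+ 2 by exact: sqr_ge0.
  lra.
rewrite subr_gt0 (le_lt_trans AB)//.
have : 2 * (A - B) < 2 * (k * P ^+ m.+2) by rewrite ltr_pM2l.
move=> /lt_le_trans; apply; rewrite mulrCA ler_pM2l//.
rewrite natrM [in leLHS]exprS [in leLHS]exprS [in leRHS]exprS.
have -> : 2 * (P * (P * P ^+ m)) = P ^+ m * (2 * P ^+ 2) by ring.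
have -> : m.+2%:R * (P * P ^+ m) * - (2 * N) + m.+2%:R * m.+1%:R * P ^+ m * (4 * s) =
  P ^+ m * (m.+2%:R * (m.+1%:R * (4 * s) - 2 * N * P)) by ring.
rewrite ler_pM2l ?exprn_gt0//.
have PQ2 : P ^+ 2 <= Q ^+ 2 by rewrite ler_pXn2r// nnegrE ltW// (lt_le_trans P0).
have NPQ : 2 * N * P <= 2 * N * Q by rewrite ler_wpM2l// mulr_ge0.
have m1s : m%:R * (4 * d) <= m.+1%:R * (4 * s).
  by rewrite ler_pM ?mulr_ge0// ?ler_nat// ler_pM2l// ltW.
have : 2 * P ^+ 2 <= m.+2%:R * P ^+ 2 by rewrite ler_wpM2r ?sqr_ge0// ler_nat.
move=> /le_trans; apply; rewrite ler_pM2l ?ltr0n//; lra.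
Qed.

(** * Lipschitz bound and quantitative strong maximum principle *)

Section lipschitz_strong_max.
Context {R : realType} {n : nat}.
Implicit Types (a b u : 'rV[R]_n -> R) (x y c p q : 'rV[R]_n) (i j : 'I_n).

Lemma allen_cahn_shift u c : allen_cahn u -> allen_cahn (fun x => u (x + c)).
Proof.
move=> [Cu Eu].
have Ex x : diag_affine (const_mx 1) c x = x + c.
  by apply/rowP => j; rewrite !mxE mul1r.
have E : (fun x => u (x + c)) = fun x => u (diag_affine (const_mx 1) c x).
  by apply/funext => x; rewrite Ex.
have one i : (const_mx 1 : 'rV[R]_n) ord0 i ^+ 2 = 1 by rewrite mxE expr1n.
split; rewrite E; first exact: C_diag_affine.
by move=> x; rewrite (laplacian_diag_affine _ _ Cu one) Eu Ex.
Qed.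

Lemma allen_cahn_lipschitz1 u x i (t : R) : allen_cahn u ->
  `|u (x + t *: delta_mx ord0 i) - u x| <= 2 * `|t|.
Proof.
move=> Au; set e := delta_mx _ _.
wlog t0 : x t / 0 <= t.
  move=> H; have [|t0] := leP 0 t; first exact: H.
  have := H (x + t *: e) (- t); rewrite scaleNr addrK distrC normrN.
  by apply; rewrite oppr_ge0 ltW.
have t2 : 0 <= t / 2 by rewrite divr_ge0.
have tE : t = 2 * (t / 2) by rewrite mulrC divfK.
have := allen_cahn_lipschitz_pos x i Au t2.
have := allen_cahn_lipschitz_pos x i (allen_cahnN Au) t2.
rewrite -tE (ger0_norm t0) -/e ler_norml.
by move: (u _) (u x) => v w; clear => *; apply/andP; split; lra.
Qed.

(** The path from [x] to [y] changes one coordinate at a time, each change being covered by the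
    one-directional bound. *)
Lemma allen_cahn_lipschitz u x y : allen_cahn u ->
  `|u y - u x| <= 2 * \sum_(i < n) `|y ord0 i - x ord0 i|.
Proof.
move=> Au.
have H (s : seq 'I_n) z : `|u (z + \sum_(i <- s) (y - x) ord0 i *: delta_mx ord0 i) - u z| <=
    2 * \sum_(i <- s) `|(y - x) ord0 i|.
  elim: s z => [|i s ih] z; first by rewrite !big_nil addr0 subrr normr0 mulr0.
  rewrite !big_cons addrA; set z' := z + _ *: _.
  rewrite -(subrK (u z') (u _)) -addrA (le_trans (ler_normD _ _))// mulrDr [leRHS]addrC.
  by rewrite lerD//; exact: allen_cahn_lipschitz1.
have := H (index_enum _) x; rewrite -row_sum_delta [x + _]addrC subrK.
by under eq_bigr do rewrite !mxE.
Qed.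

Lemma le_sqdist (r : R) x y : 0 <= r -> sqdist x y <= r ^+ 2 ->
  \sum_(i < n) `|y ord0 i - x ord0 i| <= n%:R * r.
Proof.
move=> r0 xy; rewrite mulr_natl -[n in _ *+ n]card_ord -sumr_const.
apply: ler_sum => i _.
rewrite -(@ler_pXn2r _ 2)// ?nnegrE// real_normK ?num_real//.
apply: le_trans xy; rewrite /sqdist (bigD1 i)//= lerDl.
by apply: sumr_ge0 => j _; exact: sqr_ge0.
Qed.

Lemma exists_nat_mul_gt (r t : R) : 0 < t -> exists m : nat, r < m%:R * t.
Proof.
move=> t0; exists (Num.bound `|r / t|).
rewrite -ltr_pdivrMr//; apply: le_lt_trans (ler_norm _) _.
exact: archi_boundP.
Qed.

(* Contrapositively, [a - b] is at least [th / 2] near [y] by the Lipschitz bound,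
   and stays above the subsolution [k (Q - |z - y|^2)^(m + 2)] away from [y]. *)
Lemma allen_cahn_strong_max (th r : R) : 0 < th -> 0 <= r ->
  exists2 e : R, 0 < e & forall a b x y, allen_cahn a -> allen_cahn b ->
    (forall z, b z <= a z) -> sqdist y x <= r -> a x - b x < e -> a y - b y < th.
Proof.
move=> th0 r0.
(* Within distance [de] of [y] the sum of the coordinate differences is at most [th / 8]; each of
   [a] and [b] then varies by at most [th / 4], and their difference by [th / 2]. *)
pose de := th / (8 * n.+1%:R).
have de0 : 0 < de by rewrite divr_gt0// mulr_gt0// ltr0n.
pose Q := r + 1.
have Q1 : 1 <= Q by rewrite lerDr.
have Q0 : 0 < Q := lt_le_trans ltr01 Q1.
have [m Hm] : exists m, Q ^+ 2 + 2 * n%:R * Q < m%:R * (4 * de ^+ 2).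
  by apply: exists_nat_mul_gt; rewrite mulr_gt0 ?exprn_gt0.
(* The subsolution peaks at [k * Q^(m + 2) = th / 2], hence stays below [a - b] on the small ball;
   as [Q = r + 1], it is at least [k] at [x], so [k] itself serves as [e]. It depends on [th], [r]
   and the dimension only. *)
pose k := th / 2 / Q ^+ m.+2.
have k0 : 0 < k by rewrite !divr_gt0// exprn_gt0.
exists k => // a b x y Aa Ab ab xy hx; rewrite ltNge; apply/negP => hy.
have [[Ca Ea] [Cb Eb]] := (Aa, Ab).
pose h z := a z - b z; have Ch : C_ 2 h := C_D Ca (C_N Cb).
have h0 z : 0 <= h z by rewrite subr_ge0.
have hL z : sqdist y z <= de ^+ 2 -> th / 2 <= h z.
  move=> yz; have L := le_sqdist (ltW de0) yz.
  have La := allen_cahn_lipschitz y z Aa; have Lb := allen_cahn_lipschitz y z Ab.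
  have nde : n%:R * de <= th / 8.
    have -> : th / 8 = n.+1%:R * de.
      have : n.+1%:R != 0 :> R by rewrite pnatr_eq0.
      by rewrite /de; move: (n.+1%:R : R) => N N0; field.
    by rewrite ler_pM2r// ler_nat.
  move: La Lb L nde hy; rewrite /h !ler_norml.
  move: (\sum_(i < n) _) (n%:R * _) (a z) (a y) (b z) (b y); clear.
  by move=> s t a1 a2 b1 b2 /andP[? ?] /andP[? ?] *; lra.
pose rho z := Q - sqdist y z.
have Crho l : C_ l rho := C_D (C_cst l Q) (C_N (C_sqdist l y)).
have Cr := C_M (C_cst 2 k) (C_X m.+2 (Crho 2)).
pose f z := k * rho z ^+ m.+2 - h z.
have Cf : C_ 2 f := C_D Cr (C_N Ch).
have fx : 0 < f x.
  have rx : 1 <= rho x by rewrite lerBrDl lerD2r.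
  by rewrite subr_gt0 (lt_le_trans hx)// ler_peMr ?(ltW k0)// exprn_ege1.
have [|z Kz fxz|p [Kp fxp _ lapf]] :=
    @max_principle _ _ f _ x Cf (@sqdist_ball_compact _ _ y Q).
- by rewrite /= (le_trans xy)// lerDl.
- have : sqdist y z < Q.
    rewrite lt_neqAle Kz andbT; apply/eqP => Ez.
    have := lt_le_trans fx fxz; rewrite /f /rho Ez subrr expr0n mulr0 sub0r.
    by rewrite oppr_gt0 ltNge h0.
  move=> /(near_C_lt (C_sqdist 0 y)).
  by apply: filterS => t /= /ltW.
have fp : 0 < f p := lt_le_trans fx fxp.
have rp : 0 <= rho p by rewrite subr_ge0.
have rQ : rho p <= Q by rewrite gerBl sqdist_ge0.
have rp0 : 0 < rho p.
  rewrite lt_neqAle rp andbT eq_sym; apply/eqP => E.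
  by move: fp; rewrite /f E expr0n mulr0 sub0r oppr_gt0 ltNge h0.
have far : de ^+ 2 < sqdist y p.
  rewrite ltNge; apply/negP => /hL hp.
  have : k * rho p ^+ m.+2 <= k * Q ^+ m.+2.
    by rewrite ler_pM2l// ler_pXn2r// nnegrE// ltW.
  rewrite /k divfK ?gt_eqF ?exprn_gt0// -/k => H.
  by move: fp; rewrite /f subr_gt0 ltNge (le_trans H).
have lap_rho : laplacian rho p = - (2 * n%:R).
  by rewrite (laplacianB _ (C_cst 2 _) (C_sqdist 2 _)) laplacian_cst sub0r laplacian_sqdist.
have prho i : partial i rho p ^+ 2 = partial i (sqdist y) p ^+ 2.
  have -> : rho = fun z => Q + -1 * sqdist y z.
    by apply/funext => z; rewrite mulN1r.
  rewrite (partialD _ (C_cst 1 _) (C_M (C_cst 1 _) (C_sqdist 1 _))).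
  rewrite (partialM _ (C_cst 1 _) (C_sqdist 1 _)) !partial_cst.
  by rewrite add0r mulr0 addr0 mulN1r sqrrN.
move: lapf; rewrite (laplacianB _ Cr Ch) (laplacianZ _ _ (C_X _ (Crho 2))).
rewrite (laplacianX _ _ (Crho 2)) (eq_bigr _ (fun i _ => prho i)) sum_partial_sqdist.
rewrite lap_rho (laplacianB _ Ca Cb) Ea Eb.
have hp : a p - b p < k * rho p ^+ m.+2 by rewrite -subr_gt0.
have := strong_max_ineq k0 rp0 rQ far (sqr_ge0 de) (ler0n R n) Hm hp (ab p)
  (allen_cahn_bounded p Aa) (allen_cahn_bounded p Ab).
by rewrite ltNge => /negP.
Qed.

End lipschitz_strong_max.

(** * Sliding *)

Section sliding.
Context {R : realType} {n : nat}.
Implicit Types (a b u w z : 'rV[R]_n.+1 -> R) (x y c nu : 'rV[R]_n.+1).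

Local Notation last x := (x ord0 ord_max).

Lemma allen_cahn_translate_lipschitz u x nu (s t : R) : allen_cahn u ->
  `|u (x - s *: nu) - u (x - t *: nu)| <= `|s - t| * (2 * \sum_(i < n.+1) `|nu ord0 i|).
Proof.
move=> Au; apply: le_trans (allen_cahn_lipschitz _ _ Au) _.
rewrite mulrCA ler_pM2l// mulr_sumr; apply: ler_sum => i _.
rewrite -normrM distrC !mxE le_eqVlt; apply/orP; left; apply/eqP.
by congr `| _ |; clear; ring.
Qed.

(** Outside the strip [|x_N| <= M] the comparison principle works by itself, so order only has to be
    checked in the strip. There, [gap] excludes contact for shifts above [L], and the Lipschitz
    bound in [t] turns the gap into room for sliding further; the infimum of the good shifts is
    therefore [L]. *)
Lemma sliding a b nu (M L : R) : allen_cahn a -> allen_cahn b ->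
  0 < last nu ->
  (forall x, M <= last x -> 3/4 <= a x) ->
  (forall x, last x <= - M -> b x <= - (3/4)) ->
  (forall (t : R) x, L <= t -> last x <= - M ->
     3/4 <= a x \/ b (x - t *: nu) <= - (3/4)) ->
  (forall t : R, L < t -> (forall x, b (x - t *: nu) <= a x) ->
     exists2 e : R, 0 < e & forall x, - M <= last x <= M -> e <= a x - b (x - t *: nu)) ->
  forall (t : R) x, L <= t -> b (x - t *: nu) <= a x.
Proof.
move=> Aa Ab nu0 aM bM below gap.
have Abt t : allen_cahn (fun x => b (x - t *: nu)) by exact: allen_cahn_shift.
pose S (t : R) := forall x, b (x - t *: nu) <= a x.
have strip t : L <= t ->
    (forall x, - M <= last x <= M -> b (x - t *: nu) <= a x) -> S t.
  move=> Lt H; apply: (allen_cahn_comparison Aa (Abt t)) => x abx.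
  have [Mx|xM] := leP M (last x).
    by left; have := aM _ Mx; move=> ax; split=> //; exact: le_trans ax (ltW abx).
  have [Mx|xM'] := leP (last x) (- M).
    have [ax|bx] := below t x Lt Mx.
      by left; split=> //; exact: le_trans ax (ltW abx).
    by right; split=> //; exact: le_trans (ltW abx) bx.
  by have := H x; rewrite (ltW xM) (ltW xM') leNgt abx => /(_ isT).
(* After such a shift every point below height [M] reads [b] below height [- M], where [b] is near
   -1. *)
have far t : L <= t -> 2 * M <= t * last nu -> S t.
  move=> Lt Mt; apply: (allen_cahn_comparison Aa (Abt t)) => x abx.
  have [Mx|xM] := leP M (last x).
    by left; have := aM _ Mx; move=> ax; split=> //; exact: le_trans ax (ltW abx).
  have bx : b (x - t *: nu) <= - (3/4).
    by apply: bM; rewrite !mxE; move: xM Mt; clear; lra.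
  by right; split=> //; exact: le_trans (ltW abx) bx.
(* All larger shifts are required, so that every shift above the infimum is good. *)
pose E := [set t | L <= t /\ forall s, t <= s -> S s].
have E0 : E !=set0.
  exists (Num.max L (2 * M / last nu)); split; first by rewrite le_max lexx.
  move=> s; rewrite ge_max => /andP[Ls Ms]; apply: far => //.
  by rewrite -ler_pdivrMr.
have EL : has_lbound E by exists L => t [].
have hE : has_inf E by split.
pose T := inf E.
have LT : L <= T by apply: lb_le_inf => // t [].
have ST s : T < s -> S s.
  by move=> /(inf_lt E0)[t [_ tS]] /ltW; exact: tS.
pose C := 2 * \sum_(i < n.+1) `|nu ord0 i|.
have C0 : 0 < C.
  rewrite mulr_gt0// (bigD1 ord_max)//= ltr_pwDl//; first by rewrite normr_gt0 gt_eqF.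
  by apply: sumr_ge0.
have STT : S T.
  move=> x; rewrite leNgt; apply/negP => abx.
  pose e := (b (x - T *: nu) - a x) / C.
  have e0 : 0 < e by rewrite divr_gt0// subr_gt0.
  have e2 : 0 < e / 2 by rewrite divr_gt0.
  have := ST (T + e / 2) _ x; rewrite ltrDl e2 => /(_ isT).
  have := allen_cahn_translate_lipschitz x nu (T + e / 2) T Ab.
  have -> : T + e / 2 - T = e / 2 by rewrite addrC addKr.
  rewrite -/C (gtr0_norm e2).
  have -> : e / 2 * C = (b (x - T *: nu) - a x) / 2.
    by rewrite mulrAC /e divfK// gt_eqF.
  rewrite ler_norml => /andP[+ _]; move: abx; clear.
  by move: (b _) (b _) (a x) => s t v; lra.
suff TL : T = L.
  by move=> t x; rewrite -TL le_eqVlt => /orP[/eqP <-|/ST]; [exact: STT|exact].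
apply/eqP; rewrite eq_le LT andbT leNgt; apply/negP => LT'.
have [e e0 He] := gap T LT' STT.
(* Shifts in [[T - d, T]] consume at most the gap [e] and remain above [L]. *)
pose d := Num.min (e / C) (T - L).
have d0 : 0 < d by rewrite lt_min divr_gt0//= subr_gt0.
have dC : d * C <= e by rewrite -ler_pdivlMr// ge_min lexx.
have LTd : L <= T - d by rewrite lerBrDr -lerBrDl ge_min lexx orbT.
have : T <= T - d.
  apply: ge_inf => //; split=> // s Tds.
  have [sT|] := leP s T; last exact: ST.
  apply: strip; first exact: le_trans Tds.
  move=> x /He; have := allen_cahn_translate_lipschitz x nu s T Ab.
  have : `|s - T| * C <= e.
    apply: le_trans dC; rewrite ler_pM2r// distrC ger0_norm ?subr_ge0//.
    by rewrite lerBlDr -lerBlDl.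
  rewrite -/C; move=> /[swap] /le_trans /[apply]; rewrite ler_norml => /andP[_].
  by move: (b _) (b _) (a x) => s' t v; clear; lra.
by rewrite leNgt gtrBl d0.
Qed.

(** A tiny difference at a point of the strip would propagate to a difference below 1 at a point
    under height [- M], where it is at least 3/2. The distance travelled is the same for all [x],
    hence a uniform [e]. *)
Lemma sliding_gap_profile w z nu (M t : R) : allen_cahn w -> allen_cahn z ->
  0 < last nu ->
  (forall x, last x <= - M -> 3/4 <= w x) ->
  (forall x, last x <= - M -> z x <= - (3/4)) ->
  (forall x, z (x - t *: nu) <= w x) ->
  exists2 e : R, 0 < e & forall x, - M <= last x <= M -> e <= w x - z (x - t *: nu).
Proof.
move=> Aw Az nu0 wM zM wz.
(* The first term brings the point under [- M]; [|t|] keeps its translate there also when [t] is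
   negative. *)
pose s := `|2 * M / last nu| + `|t|.
pose r := s ^+ 2 * \sum_(i < n.+1) nu ord0 i ^+ 2.
have r0 : 0 <= r by rewrite mulr_ge0 ?sqr_ge0// sumr_ge0// => i _; exact: sqr_ge0.
have [e e0 He] := @allen_cahn_strong_max R n.+1 1 r ltr01 r0.
exists e => // x /andP[_ xM]; rewrite leNgt; apply/negP => wzx.
pose y := x - s *: nu.
have := He w (fun y => z (y - t *: nu)) x y Aw (allen_cahn_shift _ Az) wz.
have -> : sqdist y x = r.
  by rewrite /sqdist /r mulr_sumr; apply: eq_bigr => i _; rewrite !mxE; clear; ring.
move=> /(_ (lexx _) wzx); apply/negP; rewrite -leNgt.
have sM : 2 * M <= (s - `|t|) * last nu.
  by rewrite -ler_pdivrMr// addrK ler_norm.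
have tt : 0 <= (`|t| + t) * last nu.
  by rewrite mulr_ge0 ?(ltW nu0)// -lerBlDr sub0r -normrN ler_norm.
have t0 : 0 <= `|t| * last nu by rewrite mulr_ge0// ltW.
have wy : 3/4 <= w y by apply: wM; rewrite !mxE; move: xM sM t0; clear; lra.
have zy : z (y - t *: nu) <= - (3/4).
  by apply: zM; rewrite !mxE; move: xM sM tt; clear; lra.
by move: wy zy; clear; move: (w y) (z _) => ? ?; lra.
Qed.

(** Here [z] and its translate have the same limit at either end, so one remote point gives no
    contradiction. Instead, a tiny difference at [x] makes all increments of [z] small along a chain
    of points with step [t nu] crossing the strip, whereas [z] must rise by 3/2 across it. *)
Lemma sliding_gap_self z nu (M t : R) : allen_cahn z ->
  0 < last nu -> 0 < t ->
  (forall x, M <= last x -> 3/4 <= z x) ->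
  (forall x, last x <= - M -> z x <= - (3/4)) ->
  (forall x, z (x - t *: nu) <= z x) ->
  exists2 e : R, 0 < e & forall x, - M <= last x <= M -> e <= z x - z (x - t *: nu).
Proof.
move=> Az nu0 t0 zM zM' zt.
have tn : 0 < t * last nu by rewrite mulr_gt0.
have [J HJ] : exists J : nat, 2 * M < J%:R * (t * last nu) by exact: exists_nat_mul_gt.
have HJ1 : 2 * M <= J.+1%:R * (t * last nu).
  by rewrite (le_trans (ltW HJ))// ler_pM2r// ler_nat.
pose r := (J.+1%:R * t) ^+ 2 * \sum_(i < n.+1) nu ord0 i ^+ 2.
have S0 : 0 <= \sum_(i < n.+1) nu ord0 i ^+ 2 by rewrite sumr_ge0// => i _; exact: sqr_ge0.
have r0 : 0 <= r by rewrite mulr_ge0 ?sqr_ge0.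
(* The chain has [2 * J.+1] steps, so its total increase is at most 1. *)
pose th : R := (2 * J.+1%:R)^-1.
have th0 : 0 < th by rewrite invr_gt0 mulr_gt0// ltr0n.
have [e e0 He] := @allen_cahn_strong_max R n.+1 th r th0 r0.
exists e => // x /andP[Mx xM]; rewrite leNgt; apply/negP => ze.
pose y k := x + (k * t) *: nu.
have ylast k : last (y k) = last x + k * (t * last nu) by rewrite !mxE mulrA.
have step k : `|k| <= J.+1%:R -> z (y k) - z (y (k - 1)) < th.
  move=> kJ; have := He z (fun y => z (y - t *: nu)) x (y k) Az (allen_cahn_shift _ Az) zt.
  have -> : y k - t *: nu = y (k - 1).
    by apply/rowP => i; rewrite !mxE; clear; ring.
  apply=> //.
  have -> : sqdist (y k) x = (k * t) ^+ 2 * \sum_(i < n.+1) nu ord0 i ^+ 2.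
    by rewrite /sqdist mulr_sumr; apply: eq_bigr => i _; rewrite !mxE; clear; ring.
  apply: ler_wpM2r => //; rewrite !exprMn ler_wpM2r ?sqr_ge0//.
  by rewrite -(real_normK (num_real k)) ler_pXn2r// nnegrE.
have tele (k : nat) : (k <= 2 * J.+1)%N ->
    z (y (k%:R - J.+1%:R)) <= z (y (- J.+1%:R)) + k%:R * th.
  elim: k => [_|k ih kJ]; first by rewrite sub0r mul0r addr0.
  have {}ih := ih (ltnW kJ).
  have := step (k.+1%:R - J.+1%:R).
  have -> : k.+1%:R - J.+1%:R - 1 = k%:R - J.+1%:R :> R by rewrite -natr1; clear; ring.
  have H : `|k.+1%:R - J.+1%:R| <= J.+1%:R :> R.
    rewrite ler_norml lerBrDr addNr ler0n/= lerBlDr -natrD ler_nat.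
    by rewrite addnn -mul2n.
  move=> /(_ H); rewrite -natr1 mulrDl mul1r; move: ih.
  by move: (z _) (z _) (z _) (k%:R * th) (th); clear => *; lra.
have := tele (2 * J.+1)%N (leqnn _).
rewrite natrM /th divff ?mulf_neq0 ?pnatr_eq0//.
have -> : 2 * J.+1%:R - J.+1%:R = J.+1%:R :> R by clear; ring.
apply/negP; rewrite -ltNge.
have z1 : 3/4 <= z (y J.+1%:R).
  by apply: zM; rewrite ylast; move: Mx HJ1; clear; lra.
have z2 : z (y (- J.+1%:R)) <= - (3/4).
  by apply: zM'; rewrite ylast mulNr; move: xM HJ1; clear; lra.
by move: z1 z2; clear; move: (z _) (z _) => ? ?; lra.
Qed.

End sliding.

(** * The one-dimensional profile *)

Section real_odes.
Context {R : realType}.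
Implicit Types (f g y : R -> R) (s t c d : R).

Lemma is_derive_ge0_nondecr f g : (forall t, is_derive t 1 f (g t)) ->
  (forall t, 0 <= g t) -> forall s t, s <= t -> f s <= f t.
Proof.
move=> fg g0 s t st.
have [|c _ E] := MVT_segment st (fun x _ => fg x).
  by apply: derivable_within_continuous => x _; have [] := fg x.
by rewrite -subr_ge0 E mulr_ge0// subr_ge0.
Qed.

Lemma nondecr_is_derive_ge0 f d t : is_derive t 1 f d ->
  (forall s t, s <= t -> f s <= f t) -> 0 <= d.
Proof.
move=> [df <-] ndf; rewrite -['D_1 f t]/(lim _).
apply: limr_ge; first exact: df.
near=> h.
have h0 : h != 0 by near: h; exact: nbhs_dnbhs_neq.
rewrite /= [h *: 1]mulr1.
have [hp|hn] := ltP 0 h.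
  apply: mulr_ge0; first by rewrite invr_ge0 ltW.
  by rewrite subr_ge0; apply: ndf; rewrite lerDr ltW.
apply: mulr_le0; first by rewrite invr_le0.
by rewrite subr_le0; apply: ndf; rewrite gerDr.
Unshelve. all: by end_near. Qed.

Lemma is_derive_expR_affine c d t :
  is_derive t 1 (fun t => expR (c * t + d)) (c * expR (c * t + d)).
Proof.
have Hc : is_derive t 1 (fun t => c * t) c.
  by have := is_deriveZ c (is_derive_id t (1 : R)); rewrite [_ *: _]mulr1.
have H : is_derive t 1 (fun t => c * t + d) c.
  by have := is_deriveD Hc (is_derive_cst d t (1 : R)); rewrite addr0.
by rewrite mulrC; exact: (is_derive1_comp (is_derive_expR _) H).
Qed.

(* Gronwall: both [f^2 exp(- 2 k t)] for [t >= t0] and [f^2 exp(2 k t)] for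
   [t <= t0] are monotone. *)
Lemma linear_ode_zero f g (k t0 : R) : (forall t, is_derive t 1 f (g t * f t)) ->
  (forall t, - k <= g t <= k) -> f t0 = 0 -> forall t, f t = 0.
Proof.
move=> df gk f0 t.
have D (c s : R) : is_derive s 1 (fun s => f s * f s * expR (c * s + 0))
    ((2 * g s + c) * (f s * f s * expR (c * s + 0))).
  have ? := df s.
  have fM : is_derive s 1 (fun s => f s * f s) (f s * (g s * f s) + f s * (g s * f s)).
    exact: is_deriveM.
  apply: is_derive_eq (is_deriveM fM (is_derive_expR_affine c 0 s)) _.
  rewrite ![_ *: _]/GRing.scale /=; move: (f s) (g s) (expR _) => *; ring.
have ge0 (c s : R) : 0 <= f s * f s * expR (c * s + 0).
  by rewrite mulr_ge0 ?expR_ge0// -expr2 sqr_ge0.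
have fin (c : R) : f t * f t * expR (c * t + 0) <= 0 -> f t = 0.
  rewrite pmulr_lle0 ?expR_gt0// -expr2 => H.
  by apply/eqP; rewrite -sqrf_eq0 eq_le H sqr_ge0.
have [tt0|t0t] := leP t t0.
  apply: (fin (2 * k)).
  apply: (@le_trans _ _ (f t0 * f t0 * expR (2 * k * t0 + 0))); last by rewrite f0 !mul0r.
  apply: (is_derive_ge0_nondecr (D (2 * k)) _ tt0) => s.
  by apply: mulr_ge0 => //; have /andP[] := gk s; move: (g s); clear => *; lra.
apply: (fin (- (2 * k))).
apply: (@le_trans _ _ (f t0 * f t0 * expR (- (2 * k) * t0 + 0))); last by rewrite f0 !mul0r.
rewrite -lerN2.
apply: (is_derive_ge0_nondecr (fun s => is_deriveN (D (- (2 * k)) s)) _ (ltW t0t)) => s.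
rewrite oppr_ge0; apply: mulr_le0_ge0 => //.
by have /andP[] := gk s; move: (g s); clear => *; lra.
Qed.

Lemma allen_cahn_ode y (y' : R -> R) :
  (forall t, is_derive t 1 y (y' t)) ->
  (forall t, is_derive t 1 y' (y t ^+ 3 - y t)) ->
  (forall t, -1 <= y t <= 1) -> (forall t, 0 <= y' t) ->
  (forall e : R, 0 < e -> exists M : R, forall t, M <= t -> `|y t - 1| < e) ->
  (exists t, y t <= 0) ->
  exists alpha : R, forall t, y t = tanh ((t + alpha) / Num.sqrt 2).
Proof.
move=> dy dy' y1 y'0 yp [tn ytn].
pose E t := y' t * y' t - (1 - y t * y t) * (1 - y t * y t) / 2.
have dE t : is_derive t 1 E 0.
  have ? := dy t; have ? := dy' t.
  have d1 : is_derive t 1 (fun t => y' t * y' t)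
    (y' t * (y t ^+ 3 - y t) + y' t * (y t ^+ 3 - y t)) by exact: is_deriveM.
  have d2 : is_derive t 1 (fun t => y t * y t) (y t * y' t + y t * y' t) by exact: is_deriveM.
  have d3 : is_derive t 1 (fun t => 1 - y t * y t) (0 - (y t * y' t + y t * y' t)).
    by apply: is_deriveB.
  have d4 := is_deriveM d3 d3.
  have d5 := is_deriveZ (2^-1) d4.
  have -> : E = (fun t => y' t * y' t) -
    (2^-1 \*: ((fun t => 1 - y t * y t) * (fun t => 1 - y t * y t))).
    by apply/funext => s; rewrite /E; congr (_ - _); rewrite mulrC.
  apply: is_derive_eq (is_deriveB (is_deriveM (dy' t) (dy' t)) d5) _.
  rewrite ![_ *: _]/GRing.scale /=; by move: (y t) (y' t); clear => *; field.
have Ecst s t : E s = E t by exact: is_derive_0_is_cst.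
(* The zero of the profile determines the translation: [alpha = - t0]. *)
have [t0 yt0] : exists t0, y t0 = 0.
  have [M HM] := yp 1 ltr01.
  pose T := Num.max M tn.
  have cy : {within `[tn, T], continuous y}.
    by apply: derivable_within_continuous => x _; have [] := dy x.
  have tT : tn <= T by rewrite le_max lexx orbT.
  have yT : 0 <= y T.
    have := HM T; rewrite le_max lexx => /(_ isT).
    by rewrite ltr_norml => /andP[+ _]; move: (y T); clear => *; lra.
  have [|c _ yc] := @IVT R y tn T 0 tT cy; last by exists c.
  by rewrite ge_min ytn le_max yT orbT.
(* The constant value of [E] is computed far to the right, at a mean value point [c] of
   [[M, M + 1]]: there [|y'| <= 2 e], since [y] stays within [e] of 1. No limit of [y'] is
   involved. *)
have E0 t : E t = 0.
  have small e : 0 < e -> e <= 1 -> `|E t| <= 9 * e.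
    move=> e0 e1; have [M HM] := yp e e0.
    have MM : M < M + 1 by rewrite ltrDl.
    have [|c] := MVT MM (fun x _ => dy x).
      by apply: derivable_within_continuous => x _; have [] := dy x.
    rewrite in_itv/= => /andP[Mc _]; rewrite [M + 1 - M]addrAC subrr add0r mulr1 => yM.
    rewrite (Ecst t c) /E.
    move: (HM _ (lexx _)) (HM _ (ltW MM)) (HM _ (ltW Mc)) yM.
    rewrite !ltr_norml; move: (y M) (y (M + 1)) (y c) (y' c) e0 e1; clear.
    move=> a b s v e0 e1 /andP[a1 a2] /andP[b1 b2] /andP[s1 s2] vE.
    have v1 : - (2 * e) <= v <= 2 * e by apply/andP; split; lra.
    have w1 : - (3 * e) <= 1 - s * s <= 3 * e.
      have -> : 1 - s * s = - ((s - 1) * (s - 1)) - 2 * (s - 1) by ring.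
      have : (s - 1) * (s - 1) <= e * e by nra.
      have : 0 <= (s - 1) * (s - 1) by rewrite -expr2 sqr_ge0.
      have : e * e <= e * 1 by rewrite ler_pM2l.
      by move=> *; apply/andP; split; lra.
    have v2 : v * v <= 4 * e.
      have : v * v <= (2 * e) * (2 * e) by move/andP: v1 => [? ?]; nra.
      have : e * e <= e * 1 by rewrite ler_pM2l.
      lra.
    have w2 : (1 - s * s) * (1 - s * s) <= 9 * e.
      have : (1 - s * s) * (1 - s * s) <= (3 * e) * (3 * e).
        by move/andP: w1 => []; move: (1 - s * s) => w *; nra.
      have : e * e <= e * 1 by rewrite ler_pM2l.
      lra.
    have v3 : 0 <= v * v by rewrite -expr2 sqr_ge0.
    have w3 : 0 <= (1 - s * s) * (1 - s * s) by rewrite -expr2 sqr_ge0.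
    by rewrite ler_norml; apply/andP; split; lra.
  apply/eqP; rewrite -normr_le0; apply/ler_addgt0Pr => e e0.
  rewrite add0r; pose d := Num.min 1 (e / 9).
  have d0 : 0 < d by rewrite lt_min ltr01 divr_gt0.
  apply: le_trans (small d d0 _) _; first by rewrite ge_min lexx.
  by rewrite mulrC -ler_pdivlMr// ge_min lexx orbT.
pose r : R := (Num.sqrt 2)^-1.
have s2 : 0 < Num.sqrt 2 :> R by rewrite sqrtr_gt0.
have r0 : 0 < r by rewrite invr_gt0.
have r2 : r * r = 2^-1 by rewrite -expr2 exprVn sqr_sqrtr.
have y'E t : y' t = r * (1 - y t * y t).
  have yy : 0 <= 1 - y t * y t.
    by have /andP[] := y1 t; move: (y t); clear => s *; nra.
  apply/eqP; rewrite -(@eqrXn2 _ 2)// ?mulr_ge0 ?(ltW r0)//.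
  have := E0 t; rewrite /E => /eqP; rewrite subr_eq0 => /eqP.
  rewrite !expr2 mulrACA r2 => ->; rewrite mulrC //.
(* [F t = 0] is the formula for tanh cleared of denominators. Separating variables would require
   dividing by [1 - y^2]; instead [F] solves a linear equation and vanishes at [t0]. *)
pose F t := (1 + y t) * expR (- r * t + r * t0) - (1 - y t) * expR (r * t + - r * t0).
have dF t : is_derive t 1 F ((- r * y t) * F t).
  have ? := dy t.
  have dp : is_derive t 1 (fun t => 1 + y t) (0 + y' t) by apply: is_deriveD.
  have dm : is_derive t 1 (fun t => 1 - y t) (0 - y' t) by apply: is_deriveB.
  have d1 := is_deriveM dp (is_derive_expR_affine (- r) (r * t0) t).
  have d2 := is_deriveM dm (is_derive_expR_affine r (- r * t0) t).
  have FE : F = (fun t => 1 + y t) * (fun t => expR (- r * t + r * t0)) -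
     (fun t => 1 - y t) * (fun t => expR (r * t + - r * t0)) by [].
  rewrite [X in is_derive _ _ X]FE; apply: is_derive_eq (is_deriveB d1 d2) _.
  rewrite ![_ *: _]/GRing.scale /= y'E /F; move: (y t) (expR _) (expR _) => *; ring.
have F0 t : F t = 0.
  apply: (@linear_ode_zero F (fun t => - r * y t) r t0) => //.
    move=> u; have /andP[] := y1 u; move: (y u) => v v1 v2; apply/andP; split.
      by rewrite mulNr lerN2 ger_pMr.
    by rewrite mulNr -mulrN ger_pMr// lerNl.
  by rewrite /F yt0 addr0 subr0 !mulNr addNr addrN subrr.
exists (- t0) => t; rewrite /tanh.
have -> : (t + - t0) / Num.sqrt 2 = r * t + - r * t0.
  by rewrite -/r mulrC mulrDr mulrN mulNr.
have -> : - (r * t + - r * t0) = - r * t + r * t0 by rewrite opprD !mulNr opprK.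
have := F0 t; rewrite /F; have := expR_gt0 (r * t + - r * t0).
have := expR_gt0 (- r * t + r * t0).
move: (expR _) (expR _) (y t); clear => A B v A0 B0 H.
have AB : A + B != 0 by rewrite gt_eqF// addr_gt0.
by apply: (mulIf AB) => /=; rewrite divfK//; move: H => *; lra.
Qed.

End real_odes.

(** * Classification of the sum and of the difference *)

Section classification.
Context {R : realType} {n : nat}.
Implicit Types (f u w z : 'rV[R]_n.+1 -> R) (x y c nu : 'rV[R]_n.+1).

Local Notation last x := (x ord0 ord_max).
Local Notation eN := (delta_mx ord0 ord_max : 'rV[R]_n.+1).

Lemma cvg_last_uniformly_pinfty f (l e : R) : cvg_last_uniformly f +oo l -> 0 < e ->
  exists M : R, forall x, M <= last x -> `|f x - l| < e.
Proof.
move=> fl /fl[M [_ HM]]; exists (M + 1) => x Mx.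
by apply: (HM (last x)) => //; rewrite (lt_le_trans _ Mx)// ltrDl.
Qed.

Lemma cvg_last_uniformly_ninfty f (l e : R) : cvg_last_uniformly f -oo l -> 0 < e ->
  exists M : R, forall x, last x <= M -> `|f x - l| < e.
Proof.
move=> fl /fl[M [_ HM]]; exists (M - 1) => x xM.
by apply: (HM (last x)) => //; rewrite (le_lt_trans xM)// gtrBl.
Qed.

Lemma last_addZ x nu (t : R) : last (x + t *: nu) = last x + t * last nu.
Proof. by rewrite !mxE. Qed.

Lemma last_eN : last eN = 1.
Proof. by rewrite mxE !eqxx. Qed.

Lemma allen_cahn_heteroclinic w z : allen_cahn w -> allen_cahn z ->
  cvg_last_uniformly w +oo 1 -> cvg_last_uniformly w -oo 1 ->
  cvg_last_uniformly z +oo 1 -> cvg_last_uniformly z -oo (-1) ->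
  exists alpha : R, forall x, w x = 1 /\ z x = tanh ((last x + alpha) / Num.sqrt 2).
Proof.
move=> Aw Az w1 w2 z1 z2.
have e4 : 0 < 4^-1 :> R by rewrite invr_gt0.
have [M1 H1] := cvg_last_uniformly_pinfty w1 e4.
have [M2 H2] := cvg_last_uniformly_ninfty w2 e4.
have [M3 H3] := cvg_last_uniformly_pinfty z1 e4.
have [M4 H4] := cvg_last_uniformly_ninfty z2 e4.
pose M := Num.max (Num.max M1 M3) (Num.max (- M2) (- M4)).
have [MM1 MM3 MM2 MM4] : [/\ M1 <= M, M3 <= M, - M2 <= M & - M4 <= M].
  by split; rewrite !le_max lexx ?orbT.
have near1 (t : R) : `|t - 1| < 4^-1 -> 3/4 <= t.
  by rewrite ltr_norml => /andP[+ _]; clear; lra.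
have near2 (t : R) : `|t - -1| < 4^-1 -> t <= - (3/4).
  by rewrite ltr_norml => /andP[_]; clear; lra.
have wM x : M <= last x -> 3/4 <= w x by move=> Mx; apply/near1/H1/le_trans/Mx.
have wM' x : last x <= - M -> 3/4 <= w x.
  by move=> Mx; apply/near1/H2/(le_trans Mx); rewrite lerNl.
have zM x : M <= last x -> 3/4 <= z x by move=> Mx; apply/near1/H3/le_trans/Mx.
have zM' x : last x <= - M -> z x <= - (3/4).
  by move=> Mx; apply/near2/H4/(le_trans Mx); rewrite lerNl.
(* Nothing stops this sliding, because [w] is near 1 at both ends: [L] is taken to be the arbitrary
   shift [t], possibly negative. *)
have wz (t : R) x : z (x - t *: eN) <= w x.
  have nu0 : 0 < last eN by rewrite last_eN.
  apply: (sliding (L := t) Aw Az nu0 wM zM') => // [s y _ yM|s _ wzs].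
    by left; exact: wM'.
  exact: (sliding_gap_profile Aw Az nu0 wM' zM' wzs).
(* The shift [last x - Me] reads [z] at height [Me], where it exceeds [1 - e]. *)
have w_1 x : w x = 1.
  apply/eqP; rewrite eq_le; have /andP[_ ->] := allen_cahn_bounded x Aw.
  apply/ler_addgt0Pr => e e0.
  have [Me He] := cvg_last_uniformly_pinfty z1 e0.
  have := wz (last x - Me) x; have := He (x - (last x - Me) *: eN).
  rewrite -scaleNr last_addZ last_eN mulr1 opprB addrC subrK lexx => /(_ isT).
  rewrite ltr_norml => /andP[+ _].
  by move: (z _) (w x) => s t; clear -e0 => *; lra.
have zz nu x : 0 < last nu -> z (x - nu) <= z x.
  move=> nu0; rewrite -[nu in x - nu]scale1r.
  apply: (sliding (L := 0) Az Az nu0 zM zM') => // [s y s0 yM|s s0 zs].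
    right; apply: zM'; rewrite -scaleNr last_addZ.
    by rewrite (le_trans _ yM)// mulNr gerBl mulr_ge0// ltW.
  exact: (sliding_gap_self Az nu0 s0 zM zM' zs).
(* A horizontal direction is a limit of admissible ones: [y - x] is tilted upwards by [e / 2], which
   the Lipschitz constant 2 turns into an error [e]. *)
have zconst x y : last x = last y -> z x = z y.
  move: x y; suff H x y : last x = last y -> z x <= z y.
    by move=> x y xy; apply: le_anti; rewrite !H.
  move=> xy; apply/ler_addgt0Pr => e e0.
  have e2 : 0 < e / 2 by rewrite divr_gt0.
  pose nu := y - x + (e / 2) *: eN.
  have nu0 : 0 < last nu.
    by rewrite last_addZ last_eN mulr1 !mxE xy subrr add0r.
  have := zz nu y nu0.
  have -> : y - nu = x + (- (e / 2)) *: eN.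
    by rewrite /nu opprD opprB addrA (addrCA y) subrr addr0 scaleNr.
  have := allen_cahn_lipschitz1 x ord_max (- (e / 2)) Az.
  rewrite normrN (gtr0_norm e2) [2 * _]mulrC divfK// ler_norml => /andP[+ _].
  by move: (z _) (z _) (z _) => s t t'; clear; lra.
have [Cz Ez] := Az.
have pz i : i != ord_max -> partial i z = fun=> 0.
  move=> iN; apply: partial_eq => x.
  have E0 : 0 *: (delta_mx ord0 i : 'rV[R]_n.+1) + x = x by rewrite scale0r add0r.
  rewrite -[x in is_derive x]E0; apply: (is_derive_line z x (delta_mx ord0 i) 0 0).2.
  have -> : (fun s : R => z (s *: delta_mx ord0 i + x)) = cst (z x).
    apply/funext => s; apply: zconst.
    by rewrite !mxE eqxx eq_sym (negPf iN) mulr0 add0r.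
  exact: is_derive_cst.
pose y (t : R) := z (t *: eN).
pose y' (t : R) := partial ord_max z (t *: eN).
have line (g : 'rV[R]_n.+1 -> R) (t : R) : C_ 1 g ->
    is_derive t (1 : R) (fun s => g (s *: eN)) (partial ord_max g (t *: eN)).
  move=> Cg; have := (is_derive_line g 0 eN t (partial ord_max g (t *: eN))).1.
  rewrite addr0 => /(_ (C_is_derive ord_max _ Cg)).
  by under eq_fun do rewrite addr0.
have dy (t : R) : is_derive t (1 : R) y (y' t) by apply: line; exact: C_SW.
have dy' (t : R) : is_derive t (1 : R) y' (y t ^+ 3 - y t).
  have := line _ t (C_partial ord_max Cz); rewrite -/(y' _).
  suff -> : partial ord_max (partial ord_max z) (t *: eN) = y t ^+ 3 - y t by [].
  rewrite /y -Ez /laplacian (bigD1 ord_max)//= big1 ?addr0// => i iN.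
  by rewrite pz// partial_cst.
have yb t : -1 <= y t <= 1 := allen_cahn_bounded _ Az.
have y'0 t : 0 <= y' t.
  apply: (nondecr_is_derive_ge0 (dy t)) => s s'.
  rewrite le_eqVlt => /orP[/eqP -> //|ss'].
  have -> : y s = z (s' *: eN - (s' - s) *: eN) by rewrite -scalerBl opprB addrC subrK.
  by apply: zz; rewrite mxE last_eN mulr1 subr_gt0.
have lastZ (t : R) : last (t *: eN) = t by rewrite mxE last_eN mulr1.
have [||alpha Halpha] := allen_cahn_ode dy dy' yb y'0.
- move=> e /(cvg_last_uniformly_pinfty z1)[Me He]; exists Me => t Mt.
  by apply: He; rewrite lastZ.
- exists (- M); have := zM' (- M *: eN); rewrite lastZ lexx => /(_ isT).
  by rewrite /y; move: (z _) => s; clear => *; lra.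
exists alpha => x; split => //.
by rewrite -Halpha /y; apply: zconst; rewrite lastZ.
Qed.

End classification.

(** * From distributional to pointwise equations *)

(** The coordinatewise form makes the preimage under [cons_rV] a segment times a cube, as the
    recursive definition of [lebesgue_rV] requires. *)
Definition cube (R : realType) n (p : 'rV[R]_n) (r : R) : set 'rV[R]_n :=
  [set x | forall i : 'I_n, `|x ord0 i - p ord0 i| <= r].

(** Slices of a function obtained by fixing coordinates inherit this with the same [M]. *)
Definition supported (R : realType) n (M : R) (f : 'rV[R]_n -> R) :=
  forall x : 'rV[R]_n, (exists i, M < `|x ord0 i|) -> f x = 0.

(** * Borel sets of row vectors, measure of cubes, integration by parts *)

Section borel_rV.
Context {R : realType}.

Lemma cons_rV0 n (t : R) (y : 'rV[R]_n) : cons_rV (t, y) ord0 ord0 = t.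
Proof. by have := congr1 fst (cons_rVK (t, y)). Qed.

Lemma cons_rVS n (t : R) (y : 'rV[R]_n) j : cons_rV (t, y) ord0 (lift ord0 j) = y ord0 j.
Proof.
have := congr1 (fun z : measurableTypeR R * 'rV[R]_n => z.2 ord0 j) (cons_rVK (t, y)).
rewrite /= mxE => <-.
by congr (cons_rV _ _ _); exact/val_inj.
Qed.

Lemma forall_ordS n (P : 'I_n.+1 -> Prop) :
  (forall i, P i) <-> P ord0 /\ forall j, P (lift ord0 j).
Proof.
split=> [H|[H0 HS] i]; first by split.
by case: (unliftP ord0 i) => [j ->|->].
Qed.

(** The sigma-algebra is generated by the coordinates; an open set is the union of the countably
    many boxes with rational centre and radius [1 / (k + 1)] that it contains. *)
Lemma open_measurable_rV n (O : set 'rV[R]_n) : open O -> measurable O.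
Proof.
move=> oO.
pose box (pk : 'rV[rat]_n * nat) :=
  \bigcap_(i in [set: 'I_n]) [set x : 'rV[R]_n | `|x ord0 i - ratr (pk.1 ord0 i)| < pk.2.+1%:R^-1].
have mbox pk : measurable (box pk).
  apply: fin_bigcap_measurable => // i _.
  rewrite -[X in measurable X]setTI.
  apply: (measurable_coor i measurableT (Y := [set t | `|t - ratr (pk.1 ord0 i)| < pk.2.+1%:R^-1])).
  apply: open_measurable.
  rewrite (_ : [set t | _] = ball (ratr (pk.1 ord0 i) : R) pk.2.+1%:R^-1); first exact: ball_open.
  by apply/seteqP; split => t /=; rewrite /ball/= distrC.
have -> : O = \bigcup_pk (if `[< box pk `<=` O >] then box pk else set0).
  apply/seteqP; split => [x Ox|x [pk _]]; last by case: asboolP => // /[apply].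
  have /nbhs_ballP[e /= e0 He] : nbhs x O by exact: open_nbhs_nbhs.
  have [k Hk] : exists k : nat, k.+1%:R^-1 < e / 2.
    have e2 : 0 < e / 2 by rewrite divr_gt0.
    exists (Num.bound (e / 2)^-1); rewrite invf_plt ?posrE ?ltr0n//.
    apply: lt_trans (archi_boundP _) _; first by rewrite invr_ge0 ltW.
    by rewrite ltr_nat.
  have k0 : 0 < k.+1%:R^-1 :> R by rewrite invr_gt0 ltr0n.
  have q i : {q : rat | `|x ord0 i - ratr q| < k.+1%:R^-1}.
    apply: cid; have ab : x ord0 i - k.+1%:R^-1 < x ord0 i + k.+1%:R^-1.
      by rewrite ltrD2l; move: (k.+1%:R^-1) k0; clear => s; lra.
    have [q] := rat_in_itvoo ab.
    by rewrite in_itv/= => qx; exists q; rewrite distrC ltr_distl.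
  have xbox : box (\row_i sval (q i), k) x.
    by move=> i _ /=; rewrite mxE; exact: svalP (q i).
  exists (\row_i sval (q i), k) => //; case: asboolP => // H; exfalso; apply: H.
  move=> y ybox; apply: He; split=> // j i; rewrite ord1 /ball/=.
  have := xbox i I; have := ybox i I; rewrite /= mxE => yi xi.
  rewrite -(subrK (ratr (sval (q i))) (x ord0 i)) -addrA (le_lt_trans (ler_normD _ _))//.
  rewrite [ltRHS](splitr e) ltrD//; first exact: lt_trans Hk.
  by rewrite distrC; exact: lt_trans Hk.
apply: countable_bigcupT_measurable; first exact: countableP.
by move=> pk; case: ifP.
Qed.

Lemma continuous_measurable_rV n (f : 'rV[R]_n -> R) : continuous f -> measurable_fun setT f.
Proof.
move=> /continuousP cf; apply: (measurability _ (RGenOpens.measurableE R)).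
move=> _ [_ [a [b ->] <-]]; rewrite setTI.
by apply: open_measurable_rV; apply: cf; exact: interval_open.
Qed.

Lemma cube_compact n (p : 'rV[R]_n) r : compact (cube p r).
Proof.
rewrite (_ : cube p r = [set v : 'rV[R]_n |
    forall i, `[p ord0 i - r, p ord0 i + r]%classic (v ord0 i)]).
  apply: (@rV_compact _ _ (fun i => `[p ord0 i - r, p ord0 i + r]%classic)) => i.
  exact: segment_compact.
by apply/seteqP; split => x /= H i; have := H i; rewrite in_itv/= ler_distl.
Qed.

Lemma cube_closed n (p : 'rV[R]_n) r : closed (cube p r).
Proof. by apply: compact_closed; [exact: norm_hausdorff|exact: cube_compact]. Qed.

Lemma cube_measurable n (p : 'rV[R]_n) r : measurable (cube p r).
Proof.
rewrite -[cube p r]setCK; apply: measurableC; apply: open_measurable_rV.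
by apply: closed_openC; exact: cube_closed.
Qed.

Lemma lebesgue_rV_cube n (p : 'rV[R]_n) r : 0 < r ->
  lebesgue_rV R n (cube p r) = ((2 * r) ^+ n)%:E.
Proof.
move=> r0; elim: n p => [p|n ih p].
  by rewrite /= diracE mem_set// => -[].
rewrite /= /lebesgue_rV_step /pushforward.
have -> : @cons_rV R n @^-1` cube p r =
    `[p ord0 ord0 - r, p ord0 ord0 + r]%classic `*` cube (\row_j p ord0 (lift ord0 j)) r.
  apply/seteqP; split => [[t y]|[t y] [/= H0 HS]] /=.
    move=> /forall_ordS[]; rewrite cons_rV0 => H0 HS; split => /=.
      by rewrite in_itv/= -ler_distl.
    by move=> j; have := HS j; rewrite cons_rVS mxE.
  apply/forall_ordS; rewrite cons_rV0; split.
    by rewrite ler_distl; rewrite in_itv in H0.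
  by move=> j; have := HS j; rewrite cons_rVS mxE.
rewrite product_measure1E//; last exact: cube_measurable.
rewrite ih exprS EFinM; congr (_ * _)%E.
apply: etrans (lebesgue_measure_itv _) _; rewrite /= lte_fin.
have -> : p ord0 ord0 - r < p ord0 ord0 + r.
  by move: (p _ _) r0; clear => s; lra.
by rewrite -EFinB; congr EFin; move: (p _ _); clear => s; ring.
Qed.

Lemma integrable_supported n (f : 'rV[R]_n -> R) (M : R) : continuous f -> supported M f ->
  (lebesgue_rV R n).-integrable setT (EFin \o f).
Proof.
(* Positive whatever the sign of [M], as the measure of cubes demands. *)
move=> cf fM; pose r := `|M| + 1.
have r0 : 0 < r by rewrite ltr_wpDl.
have mf := continuous_measurable_rV cf.
have mc := cube_measurable (0 : 'rV[R]_n) r.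
have -> : EFin \o f = (EFin \o f) \_ (cube 0 r).
  apply/funext => x; rewrite patchE; case: ifPn => // /negP.
  rewrite inE => /existsNP[i /negP]; rewrite mxE subr0 -ltNge => xi /=.
  rewrite fM//; exists i; apply: le_lt_trans xi; rewrite /r.
  by rewrite (le_trans (ler_norm M))// lerDl.
apply/integrable_restrict => //; rewrite setTI.
apply: measurable_bounded_integrable => //.
- by have := ltry ((2 * r) ^+ n); rewrite -(lebesgue_rV_cube (0 : 'rV[R]_n) r0).
- exact: measurable_funTS.
- have cfc : {within cube 0 r, continuous f} by exact: continuous_subspaceT.
  have [N [Nr HN]] := compact_bounded (continuous_compact cfc (@cube_compact n 0 r)).
  by exists N; split => // y Ny x cx; apply: (HN _ Ny); exists x.
Qed.


Lemma cons_rV_continuousl n (y : 'rV[R]_n) : continuous (fun t : R => cons_rV (t, y)).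
Proof.
apply: rV_continuous => i; case: (unliftP ord0 i) => [j ->|->].
  rewrite (_ : (fun t => _) = cst (y ord0 j)); first exact: cst_continuous.
  by apply/funext => t; rewrite cons_rVS.
rewrite (_ : (fun t => _) = id); first by move=> t; exact: cvg_id.
by apply/funext => t; rewrite cons_rV0.
Qed.

Lemma cons_rV_continuousr n (t : R) : continuous (fun y : 'rV[R]_n => cons_rV (t, y)).
Proof.
apply: rV_continuous => i; case: (unliftP ord0 i) => [j ->|->].
  rewrite (_ : (fun t => _) = (fun y : 'rV[R]_n => y ord0 j)).
    exact: coord_continuous.
  by apply/funext => y; rewrite cons_rVS.
rewrite (_ : (fun t => _) = cst t); first exact: cst_continuous.
by apply/funext => y; rewrite cons_rV0.
Qed.

Lemma continuous1_supported_integral0 (f g : R -> R) (M : R) :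
  (forall t : R, is_derive t (1 : R) f (g t)) -> continuous g ->
  (forall t, M < `|t| -> f t = 0) -> (forall t, M < `|t| -> g t = 0) ->
  (\int[@lebesgue_measure R]_t (g t)%:E = 0)%E.
Proof.
move=> fg cg fM gM; pose A := `|M| + 1.
have A0 : 0 < A by rewrite ltr_wpDl.
have MA : M < A by rewrite (le_lt_trans (ler_norm M))// ltrDl.
have cf : continuous f by move=> t; exact: is_derive_continuous1 (fg t).
have -> : (fun t => (g t)%:E) = (fun t => (g t)%:E) \_ `[- A, A]%classic.
  apply/funext => t; rewrite patchE; case: ifPn => // /negP.
  rewrite inE/= in_itv/= -ler_norml => /negP; rewrite -ltNge => tA.
  by rewrite gM// (lt_trans MA).
rewrite -integral_mkcond (@continuous_FTC2 _ g f).
- by rewrite !fM ?subee// ?normrN (gtr0_norm A0).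
- by move: A0; clear; lra.
- exact: continuous_subspaceT.
- split.
  + by move=> t _; have [] := fg t.
  + by apply: cvg_at_right_filter; exact: cf.
  + by apply: cvg_at_left_filter; exact: cf.
- by move=> t _; rewrite derive1E; have [_ ->] := fg t.
Qed.

Lemma row_addZ_delta n (s : R) (i j : 'I_n) (x : 'rV[R]_n) :
  (s *: delta_mx ord0 i + x) ord0 j = s * (j == i)%:R + x ord0 j.
Proof. by rewrite !mxE eqxx. Qed.

Lemma is_derive_cons0 n (F : 'rV[R]_n.+1 -> R) (t d : R) (y : 'rV[R]_n) :
  is_derive (cons_rV (t, y)) (delta_mx ord0 ord0) F d ->
  is_derive t (1 : R) (fun t => F (cons_rV (t, y))) d.
Proof.
have E (s : R) : cons_rV (s, y) = s *: delta_mx ord0 ord0 + cons_rV (0, y).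
  apply/rowP => i; rewrite row_addZ_delta.
  case: (unliftP ord0 i) => [j ->|->].
    by rewrite !cons_rVS eq_sym (negPf (neq_lift _ _)) /= mulr0 add0r.
  by rewrite !cons_rV0 eqxx mulr1 addr0.
rewrite E => /(is_derive_line F _ _ t d).1.
by under eq_fun do rewrite -E.
Qed.

Lemma is_derive_consS n (F : 'rV[R]_n.+1 -> R) (t d : R) (y : 'rV[R]_n) j :
  is_derive (cons_rV (t, y)) (delta_mx ord0 (lift ord0 j)) F d ->
  is_derive y (delta_mx ord0 j) (fun y => F (cons_rV (t, y))) d.
Proof.
have E (s : R) : cons_rV (t, s *: delta_mx ord0 j + y) =
    s *: delta_mx ord0 (lift ord0 j) + cons_rV (t, y).
  apply/rowP => i; rewrite row_addZ_delta.
  case: (unliftP ord0 i) => [k ->|->].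
    by rewrite !cons_rVS row_addZ_delta (inj_eq lift_inj).
  by rewrite !cons_rV0 (negPf (neq_lift _ _)) mulr0 add0r.
have E0 m (v y' : 'rV[R]_m) : 0 *: v + y' = y'.
  by rewrite scale0r add0r.
move=> H; rewrite -[y in is_derive y](E0 _ (delta_mx ord0 j) y).
apply: (is_derive_line _ y _ 0 d).2.
under eq_fun do rewrite E.
by apply: (is_derive_line F _ _ 0 d).1; rewrite E0.
Qed.

(** By Fubini the variable of differentiation is placed in the inner integral: for the first
    coordinate the fundamental theorem of calculus applies to it, for the others the induction
    hypothesis on slices. *)
Lemma integral_supported_partial n (i : 'I_n) (F G : 'rV[R]_n -> R) (M : R) :
  continuous G -> supported M F -> supported M G ->
  (forall x, is_derive x (delta_mx ord0 i) F (G x)) ->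
  (\int[lebesgue_rV R n]_x (G x)%:E = 0)%E.
Proof.
elim: n i F G => [[]//|n ih] i F G cG FM GM FG.
have mG := continuous_measurable_rV cG.
have mGE : measurable_fun setT (EFin \o G) by exact/measurable_EFinP.
have iG := integrable_supported cG GM.
(* Fubini is used on the product measure, of which the measure at hand is the image under
   [cons_rV]. *)
have iGc : (@lebesgue_measure R \x lebesgue_rV R n)%E.-integrable setT
    ((EFin \o G) \o @cons_rV R n).
  apply/integrableP; split.
    by apply: measurableT_comp => //; exact: measurable_cons_rV.
  have /integrableP[_] := iG; apply: le_lt_trans.
  rewrite /= /lebesgue_rV_step (ge0_integral_pushforward (@measurable_cons_rV R n))//.
  by do 2 apply: measurableT_comp => //.
rewrite /= /lebesgue_rV_step (integral_pushforward (@measurable_cons_rV R n) mGE)//.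
rewrite preimage_setT.
case: (unliftP ord0 i) FG => [j ->|->] FG.
  rewrite -integral12_prod_meas1//; apply: integral0_eq => t _.
  apply: (ih j (fun y => F (cons_rV (t, y))) (fun y => G (cons_rV (t, y)))).
  - by move=> y; apply: continuous_comp; [exact: cons_rV_continuousr|exact: cG].
  - by move=> y [k yk]; apply: FM; exists (lift ord0 k); rewrite cons_rVS.
  - by move=> y [k yk]; apply: GM; exists (lift ord0 k); rewrite cons_rVS.
  - by move=> y; exact: is_derive_consS.
rewrite -integral21_prod_meas1//; apply: integral0_eq => y _.
apply: (@continuous1_supported_integral0 (fun t => F (cons_rV (t, y)))
  (fun t => G (cons_rV (t, y))) M).
- by move=> t; exact: is_derive_cons0.
- by move=> t; apply: continuous_comp; [exact: cons_rV_continuousl|exact: cG].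
- by move=> t tM; apply: FM; exists ord0; rewrite cons_rV0.
- by move=> t tM; apply: GM; exists ord0; rewrite cons_rV0.
Qed.

End borel_rV.

(** * Smooth bump functions supported in cubes *)

Section bump_functions.
Context {R : realType}.
Implicit Types (t : R) (m k : nat).

(* The functions [t^(-m) exp(-1/t)], whose span is closed under differentiation. *)
Definition flat m t : R := if 0 < t then t^-1 ^+ m * expR (- t^-1) else 0.

Lemma flat_ge0 m t : 0 <= flat m t.
Proof.
rewrite /flat; case: ltP => // t0.
by rewrite mulr_ge0 ?expR_ge0// exprn_ge0// invr_ge0 ltW.
Qed.

Lemma flat_gt0 m t : 0 < t -> 0 < flat m t.
Proof. by move=> t0; rewrite /flat t0 mulr_gt0 ?expR_gt0// exprn_gt0// invr_gt0. Qed.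

Lemma flat_le0 m t : t <= 0 -> flat m t = 0.
Proof. by move=> t0; rewrite /flat ltNge t0. Qed.

(** This is [exp s >= s^(m + 1) / (m + 1)!] at [s = 1 / t]. It yields differentiability at 0, where
    the difference quotient of [flat m] from the right is [flat m.+1]. *)
Lemma flat_bound m t : flat m t <= m.+1`!%:R * `|t|.
Proof.
have [t0|t0] := ltP 0 t; last by rewrite flat_le0// mulr_ge0.
have s0 : 0 <= t^-1 by rewrite invr_ge0 ltW.
rewrite /flat t0 gtr0_norm// -ler_pdivrMr// expRN mulrAC -exprSr.
rewrite ler_pdivrMr ?expR_gt0// mulrC -ler_pdivrMr ?ltr0n ?fact_gt0//.
by apply: le_trans (expR_ge1Dxn m s0); rewrite lerDr.
Qed.

Lemma is_derive_flat m t :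
  is_derive t 1 (flat m) (- m%:R * flat m.+1 t + flat m.+2 t).
Proof.
have [t0|t0|->] := ltgtP t 0.
- rewrite (flat_le0 m.+1 (ltW t0)) (flat_le0 m.+2 (ltW t0)) mulr0 addr0.
  apply: (near_eq_is_derive (f := cst 0)) (is_derive_cst _ _ _).
  near=> s; rewrite /= flat_le0//; apply: ltW; near: s; exact: lt_nbhsl.
- rewrite /flat t0.
  have tn0 : t != 0 by rewrite gt_eqF.
  have di : is_derive t (1 : R) (fun s : R => s^-1) (- t ^- 2).
    by have := is_deriveV tn0 (is_derive_id t (1 : R)); rewrite [_ *: _]mulr1.
  have de := is_derive1_comp (is_derive_expR _) (is_deriveN di).
  have dM := is_deriveM (is_deriveX m di) de.
  have := near_eq_is_derive (g := fun s : R => if 0 < s then s^-1 ^+ m * expR (- s^-1) else 0) _ dM.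
  rewrite [X in is_derive _ _ _ X](_ : _ =
     - m%:R * (t^-1 ^+ m.+1 * expR (- t^-1)) + t^-1 ^+ m.+2 * expR (- t^-1)).
    apply; near=> s; rewrite ifT; first by rewrite exprfctE.
    by near: s; exact: lt_nbhsr.
  rewrite ![_ *: _]/GRing.scale /= exprfctE opprK -exprVn.
  case: m {dM} => [|m]; first by rewrite !mul0r mulr0 oppr0 mul0r addr0 add0r expr0 mul1r mulrC.
  rewrite opprfctE /= !exprS; move: (t^-1) (t^-1 ^+ m) (expR _) => *; ring.
- rewrite !flat_le0// mulr0 addr0.
  have H : h^-1 *: ((flat m \o shift 0) (h *: (1 : R)) - flat m 0) @[h --> 0^'] --> (0 : R).
    apply/cvgr0Pnorm_lt => e e0.
    have C0 : 0 < m.+2`!%:R :> R by rewrite ltr0n fact_gt0.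
    near=> h; rewrite /= /shift addr0 [h *: 1]mulr1 (flat_le0 m (lexx 0)) subr0.
    have h0 : h != 0 by near: h; exact: nbhs_dnbhs_neq.
    have he : m.+2`!%:R * `|h| < e.
      rewrite -ltr_pdivlMl//; near: h; apply: dnbhs0_lt.
      by rewrite mulr_gt0 ?invr_gt0.
    apply: le_lt_trans he; have [hp|hn] := ltP 0 h; last first.
      by rewrite flat_le0// scaler0 normr0 mulr_ge0.
    have -> : h^-1 *: flat m h = flat m.+1 h.
      by rewrite /flat hp [_ *: _]mulrA exprS.
    by rewrite ger0_norm ?flat_ge0//; exact: flat_bound.
  by split; [exact: (cvgP _ H)|exact: (cvg_lim _ H)].
Unshelve. all: by end_near. Qed.

Lemma C_flat n k m (f : 'rV[R]_n -> R) : smooth f -> C_ k (fun x => flat m (f x)).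
Proof.
move=> sf; elim: k m => [|k ih] m.
  move=> x; apply: continuous_comp; first exact: (@C_continuous _ _ 0 _ (sf 0%N)).
  exact: is_derive_continuous1 (is_derive_flat m _).
apply: (@C_intro _ _ _ _ (fun i x => (- m%:R * flat m.+1 (f x) + flat m.+2 (f x)) * partial i f x)).
- move=> x; apply: continuous_comp; first exact: (@C_continuous _ _ 0 _ (sf 0%N)).
  exact: is_derive_continuous1 (is_derive_flat m _).
- by move=> i x; apply: (is_derive_comp _ (sf 1%N)); exact: is_derive_flat.
- move=> i; apply: C_M; last exact: (C_partial i (sf k.+1)).
  by apply: C_D; [apply: C_M; [exact: C_cst|exact: ih]|exact: ih].
Qed.

Definition cube_bump n (p : 'rV[R]_n) (r : R) (x : 'rV[R]_n) : R :=
  \prod_(i < n) (flat 0 (x ord0 i - p ord0 i + r) * flat 0 (r - (x ord0 i - p ord0 i))).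

Lemma cube_bump_smooth n (p : 'rV[R]_n) r : smooth (cube_bump p r).
Proof.
move=> k; apply: C_prod => i; have C1 j : C_ j (fun x : 'rV[R]_n => x ord0 i - p ord0 i).
  by apply: C_D; [exact: C_coord|exact: C_cst].
apply: C_M; apply: C_flat => j.
  by apply: C_D; [exact: C1|exact: C_cst].
by apply: C_D; [exact: C_cst|exact/C_N/C1].
Qed.

Lemma cube_bump_ge0 n (p x : 'rV[R]_n) r : 0 <= cube_bump p r x.
Proof. by apply: prodr_ge0 => i _; rewrite mulr_ge0// flat_ge0. Qed.

Lemma cube_bump_gt0 n (p x : 'rV[R]_n) r :
  (forall i, `|x ord0 i - p ord0 i| < r) -> 0 < cube_bump p r x.
Proof.
move=> xp; apply: prodr_gt0 => i _; have := xp i; rewrite ltr_norml => /andP[x1 x2].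
by rewrite mulr_gt0// flat_gt0 ?subr_gt0// -ltrBlDr sub0r.
Qed.

Lemma cube_bump_eq0 n (p x : 'rV[R]_n) r :
  (exists i, r <= `|x ord0 i - p ord0 i|) -> cube_bump p r x = 0.
Proof.
move=> [i]; rewrite ler_normr => /orP xp.
apply/eqP; rewrite prodf_seq_eq0; apply/hasP; exists i; first exact: mem_index_enum.
rewrite /= mulf_eq0; case: xp => xp.
  by rewrite orbC flat_le0 ?eqxx// subr_le0.
by rewrite flat_le0 ?eqxx// -lerBrDr sub0r lerNr.
Qed.

Lemma cube_bump_test_function n (p : 'rV[R]_n) r : test_function (cube_bump p r).
Proof.
split; first exact: cube_bump_smooth.
apply: (subclosed_compact _ (@cube_compact _ _ p r)); first exact: closed_closure.
rewrite [X in _ `<=` X](closure_id _).1; last exact: cube_closed.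
apply: closureS => x /= /eqP; apply: contra_notP => /existsNP[i /negP].
by rewrite -ltNge => xi; apply: cube_bump_eq0; exists i; exact: ltW.
Qed.

End bump_functions.

(** * From weak to pointwise equations for the smooth representatives *)

Section weak_solutions.
Context {R : realType} {n : nat}.
Implicit Types (f g u v U G phi : 'rV[R]_n -> R) (x p : 'rV[R]_n) (i j : 'I_n).

Let mu := lebesgue_rV R n.

Lemma supported_partial (M : R) f i : supported M f -> supported M (partial i f).
Proof.
move=> fM x [j xj]; rewrite /partial (near_eq_derive _ (g := cst 0)) ?derive_cst//.
have Cj := @C_coord R n 0 j.
have : \forall y \near x, M < `|(y : 'rV[R]_n) ord0 j|.
  exact: (cvgr_gt _ (cvg_norm (@C_continuous _ _ _ _ Cj x))).
by apply: filterS => y yj; rewrite fM//; exists j.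
Qed.

Lemma supportedM (M : R) f g : supported M g -> supported M (fun x => f x * g x).
Proof. by move=> gM x xM; rewrite gM// mulr0. Qed.

Lemma cube_bump_supported p (r : R) : exists M : R, supported M (cube_bump p r).
Proof.
exists (`|p| + r) => x [i xi]; apply: cube_bump_eq0; exists i.
have pi : `|p ord0 i| <= `|p|.
  rewrite [leRHS]/Num.norm /= mx_normrE.
  by apply/bigmax_geP; right; exists (ord0, i).
have := ler_normD (x ord0 i - p ord0 i) (p ord0 i); rewrite subrK.
by move: xi pi; move: `|x ord0 i| `|p ord0 i| `|p| `|_|; clear => *; lra.
Qed.

(** If [f p > 0], a bump concentrated near [p] sees only positive values of [f]. Its integral
    against [f] is bounded below on the cube of half the radius, where the bump has a positive
    minimum. *)
Lemma cube_bump_orthogonal_le0 f : continuous f ->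
  (forall p (r : R), 0 < r -> (\int[mu]_x (cube_bump p r x * f x)%:E = 0)%E) ->
  forall p, f p <= 0.
Proof.
move=> cf int0 p; rewrite leNgt; apply/negP => fp.
have fp2 : f p / 2 < f p by move: fp; clear; lra.
have /nbhs_ballP[e /= e0 He] : \forall x \near p, f p / 2 < f x.
  exact: (cvgr_gt _ (cf p)).
have big x : (forall i, `|x ord0 i - p ord0 i| < e) -> f p / 2 < f x.
  by move=> xp; apply: He; split=> // j i; rewrite ord1 /ball/= distrC.
pose h x := cube_bump p e x * f x.
have ch : continuous h.
  apply: (@C_M _ _ 0); [exact: (cube_bump_smooth p e 0)|exact: cf].
have h0 x : 0 <= h x.
  have [xp|] := pselect (forall i, `|x ord0 i - p ord0 i| < e).
    rewrite mulr_ge0 ?cube_bump_ge0// ltW// (lt_trans _ (big x xp))//.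
    by rewrite divr_gt0.
  move=> /existsNP[i /negP]; rewrite -leNgt => xi.
  by rewrite /h cube_bump_eq0 ?mul0r//; exists i.
have e2 : 0 < e / 2 by rewrite divr_gt0.
have e2e : e / 2 < e by move: e0; clear; lra.
pose K := cube p (e / 2).
have pK : K p by move=> i; rewrite subrr normr0 ltW.
have [q qK minq] : exists2 q, q \in K & forall x, x \in K -> cube_bump p e q <= cube_bump p e x.
  apply: EVT_min_rV; [by exists p|exact: cube_compact|].
  by apply: continuous_subspaceT; exact: (@C_continuous _ _ _ _ (cube_bump_smooth p e 0)).
have {}qK : K q by rewrite inE in qK.
pose m := cube_bump p e q.
have m0 : 0 < m by apply: cube_bump_gt0 => i; exact: le_lt_trans (qK i) e2e.
have mf : measurable_fun setT (fun x => (h x)%:E).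
  by apply/measurable_EFinP; exact: continuous_measurable_rV.
have mK : measurable K by exact: cube_measurable.
have c0 : 0 < m * (f p / 2) by rewrite mulr_gt0// divr_gt0.
have : ((m * (f p / 2))%:E * mu K <= \int[mu]_x (h x)%:E)%E.
  rewrite -integral_cst//.
  apply: (@le_trans _ _ (\int[mu]_(x in K) (h x)%:E)%E).
    apply: ge0_le_integral => //.
    - by move=> x _; rewrite lee_fin ltW.
    - exact: measurable_funTS.
    - move=> x Kx; rewrite lee_fin /h ler_pM//.
      + exact: ltW.
      + by rewrite ltW// divr_gt0.
      + by apply: minq; rewrite inE.
      + by apply/ltW/big => i; exact: le_lt_trans (Kx i) e2e.
  by apply: ge0_subset_integral => // x _; rewrite lee_fin.
have -> : mu K = ((2 * (e / 2)) ^+ n)%:E by exact: lebesgue_rV_cube.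
rewrite int0// -EFinM lee_fin; apply/negP; rewrite -ltNge.
by rewrite mulr_gt0// exprn_gt0// mulr_gt0.
Qed.

Lemma cube_bump_orthogonal_eq0 f : continuous f ->
  (forall p (r : R), 0 < r -> (\int[mu]_x (cube_bump p r x * f x)%:E = 0)%E) ->
  forall p, f p = 0.
Proof.
move=> cf int0 p; apply/eqP; rewrite eq_le cube_bump_orthogonal_le0//=.
rewrite -oppr_le0; apply: (@cube_bump_orthogonal_le0 (fun x => - f x)).
  exact: (@C_N _ _ 0 _ cf).
move=> q r r0; have [M bM] := cube_bump_supported q r.
under eq_integral do rewrite mulrN EFinN.
have iF : mu.-integrable setT (EFin \o (fun x => cube_bump q r x * f x)).
  apply: (integrable_supported (M := M)).
    by apply: (@C_M _ _ 0); [exact: (cube_bump_smooth q r 0)|exact: cf].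
  by move=> x xM; rewrite bM// mul0r.
by rewrite integralN/= ?int0 ?oppe0//; exact: (integrable_add_def measurableT iF).
Qed.

(** Bumps suffice as test functions: Green's identity moves the Laplacian from the bump back to [U],
    so the continuous function [G + laplacian U] is orthogonal to all of them. *)
Lemma distr_laplacian_pointwise u g U G :
  measurable_fun setT u -> measurable_fun setT g ->
  C_ 2 U -> continuous G ->
  {ae mu, forall x, u x = U x} -> {ae mu, forall x, g x = G x} ->
  neg_laplacian_distr u g -> forall x, - laplacian U x = G x.
Proof.
move=> mu_ mg CU cG uU gG ug.
pose H x := G x + laplacian U x.
have cL f : C_ 2 f -> continuous (laplacian f).
  by move=> Cf; apply: (@C_sum _ _ 0) => i; exact: (C_partial i (C_partial i Cf)).
have cH : continuous H by apply: (@C_D _ _ 0); [exact: cG|exact: cL].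
suff H0 : forall x, H x = 0.
  move=> x; have := H0 x; rewrite /H.
  by move: (G x) (laplacian U x) => a b; clear; lra.
apply: cube_bump_orthogonal_eq0 => // p r r0.
pose phi := cube_bump p r; have sphi : smooth phi := cube_bump_smooth p r.
have [M pM] := cube_bump_supported p r.
have test : test_function phi := cube_bump_test_function p r.
have Lphi : supported M (laplacian phi).
  by move=> x xM; apply: big1 => i _; exact: (supported_partial i (supported_partial i pM)).
have cU := @C_continuous _ _ _ _ CU.
have cphi := @C_continuous _ _ _ _ (sphi 0%N).
have int k : continuous k -> supported M k -> mu.-integrable setT (EFin \o k).
  by move=> ck kM; exact: integrable_supported ck kM.
pose a x := G x * phi x; pose b x := U x * - laplacian phi x.
(* This is the [i]-th partial derivative of [U * partial i phi - phi * partial i U], a function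
   supported with [phi]; its integral vanishes. *)
pose c i x := U x * partial i (partial i phi) x - phi x * partial i (partial i U) x.
have ca : continuous a by apply: (@C_M _ _ 0).
have cb : continuous b.
  by apply: (@C_M _ _ 0) => //; apply: (@C_N _ _ 0); apply: cL; exact: sphi.
have cc i : continuous (c i).
  apply: (@C_D _ _ 0); first apply: (@C_M _ _ 0) => //.
    exact: (C_partial i (C_partial i (sphi 2%N))).
  apply: (@C_N _ _ 0); apply: (@C_M _ _ 0) => //.
  exact: (C_partial i (C_partial i CU)).
have aM : supported M a by exact: supportedM.
have bM : supported M b by apply: supportedM => x xM; rewrite Lphi// oppr0.
have cM i : supported M (c i).
  move=> x xM; have phi0 : phi x = 0 := pM x xM.
  rewrite /c phi0 mul0r subr0.
  by rewrite (supported_partial i (supported_partial i pM))// mulr0.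
have ia := int a ca aM; have ib := int b cb bM.
have ic i := int (c i) (cc i) (cM i).
have int_c i : (\int[mu]_x (c i x)%:E = 0)%E.
  apply: (@integral_supported_partial R n i
     (fun x => U x * partial i phi x - phi x * partial i U x) (c i) M) => //.
    move=> x xM; have phi0 : phi x = 0 := pM x xM.
    rewrite phi0 mul0r subr0.
    by rewrite (supported_partial i pM)// mulr0.
  move=> x.
  have dU := C_is_derive i x CU; have dp := C_is_derive i x (sphi 1%N).
  have dU' := C_is_derive i x (C_partial i CU).
  have dp' := C_is_derive i x (C_partial i (sphi 2%N)).
  apply: is_derive_eq (is_deriveB (is_deriveM dU dp') (is_deriveM dp dU')) _.
  rewrite ![_ *: _]/GRing.scale /= /c.
  move: (U x) (phi x) (partial i U x) (partial i phi x).
  move: (partial i (partial i U) x) (partial i (partial i phi) x); clear => *; ring.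
have Eab : (\int[mu]_x (b x)%:E = \int[mu]_x (a x)%:E)%E.
  have mphi : measurable_fun setT phi by exact: continuous_measurable_rV.
  have mL : measurable_fun setT (fun x => - laplacian phi x).
    by apply: continuous_measurable_rV; apply: (@C_N _ _ 0); apply: cL; exact: sphi.
  have := ug phi test; rewrite -/mu.
  rewrite (ae_eq_integral (fun x => (b x)%:E))//; last 3 first.
  - by apply/measurable_EFinP; exact: measurable_funM.
  - by apply/measurable_EFinP; exact: continuous_measurable_rV.
  - by apply: filterS uU => x ux _; rewrite /b ux.
  rewrite (ae_eq_integral (fun x => (a x)%:E) (fun x => (g x * phi x)%:E))//.
  - by apply/measurable_EFinP; exact: measurable_funM.
  - by apply/measurable_EFinP; exact: continuous_measurable_rV.
  - by apply: filterS gG => x gx _; rewrite /a gx.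
have sum_c x : \sum_(i < n) c i x = U x * laplacian phi x - phi x * laplacian U x.
  by rewrite [in RHS]/laplacian !mulr_sumr -sumrB.
have E x : (phi x * H x)%:E = ((a x)%:E - (b x)%:E - \sum_(i < n) (c i x)%:E)%E.
  rewrite sumEFin sum_c -!EFinB /a /b /H; congr EFin.
  move: (phi x) (U x) (G x) (laplacian U x) (laplacian phi x); clear => *; ring.
under eq_integral do rewrite E.
have isum : mu.-integrable setT (fun x => (\sum_(i < n) (c i x)%:E)%E).
  by apply: (@integrable_sum _ _ _ mu) => // i _; exact: ic.
have iab := integrableB measurableT ia ib.
rewrite [LHS](integralB measurableT iab isum) (integralB measurableT ia ib).
rewrite integral_sum//=.
rewrite big1 => [|i _]; last exact: int_c.
rewrite Eab sube0 subee//.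
exact: integrable_fin_num.
Qed.

End weak_solutions.

Theorem theorem1p8 (R : realType) (n : nat) (u v U V : 'rV[R]_n.+1 -> R)
  (sol_uv : solution u v)
  (repU : smooth_representative u U) (repV : smooth_representative v V)
  (U_pinfty : cvg_last_uniformly U +oo 1)
  (V_pinfty : cvg_last_uniformly V +oo 0)
  (U_ninfty : cvg_last_uniformly U -oo 0)
  (V_ninfty : cvg_last_uniformly V -oo 1) :
  exists alpha : R, forall x : 'rV[R]_n.+1,
    U x = (1 + tanh ((x ord0 ord_max + alpha) / Num.sqrt 2)) / 2 /\
    V x = (1 - tanh ((x ord0 ord_max + alpha) / Num.sqrt 2)) / 2.
Proof.
have [[mu_ _] [mv_ _] equ eqv] := sol_uv.
have [[sU aeU] [sV aeV]] := (repU, repV).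
have cU : C_ 0 U := sU 0%N; have cV : C_ 0 V := sV 0%N.
have lapU x : laplacian U x = - (U x - U x ^+ 3 - 3 * U x * V x ^+ 2).
  rewrite -[LHS]opprK; congr (- _).
  apply: (distr_laplacian_pointwise (u := u)
    (g := fun x => u x - u x ^+ 3 - 3 * u x * v x ^+ 2)
    (G := fun x => U x - U x ^+ 3 - 3 * U x * V x ^+ 2)) => //.
  - apply: measurable_funB; first apply: measurable_funB => //.
      exact: measurable_funX.
    by apply: measurable_funM; [exact: measurable_funM|exact: measurable_funX].
  - apply: (@C_D _ _ 0); first by apply: (C_D cU); apply: C_N; exact: C_X.
    by apply: C_N; apply: C_M; [apply: C_M => //; exact: C_cst|exact: C_X].
  - by apply: filterS2 aeU aeV => y -> ->.
have lapV x : laplacian V x = - (V x - V x ^+ 3 - 3 * U x ^+ 2 * V x).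
  rewrite -[LHS]opprK; congr (- _).
  apply: (distr_laplacian_pointwise (u := v)
    (g := fun x => v x - v x ^+ 3 - 3 * u x ^+ 2 * v x)
    (G := fun x => V x - V x ^+ 3 - 3 * U x ^+ 2 * V x)) => //.
  - apply: measurable_funB; first apply: measurable_funB => //.
      exact: measurable_funX.
    by apply: measurable_funM => //; apply: measurable_funM => //; exact: measurable_funX.
  - apply: (@C_D _ _ 0); first by apply: (C_D cV); apply: C_N; exact: C_X.
    by apply: C_N; apply: C_M => //; apply: C_M; [exact: C_cst|exact: C_X].
  - by apply: filterS2 aeU aeV => y -> ->.
pose w x := U x + V x; pose z x := U x - V x.
have Aw : allen_cahn w.
  split=> [|x]; first exact: C_D.
  by rewrite (laplacianD _ (sU 2%N) (sV 2%N)) lapU lapV /w; move: (U x) (V x); clear => *; ring.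
have Az : allen_cahn z.
  split=> [|x]; first exact: (C_D (sU 2%N) (C_N (sV 2%N))).
  by rewrite (laplacianB _ (sU 2%N) (sV 2%N)) lapU lapV /z; move: (U x) (V x); clear => *; ring.
(* The sign [s] treats the sum and the difference at once. *)
have cvgD (F : set_system R) (FF : Filter F) (f g : 'rV[R]_n.+1 -> R) (a b s : R) :
    `|s| = 1 -> cvg_last_uniformly f F a -> cvg_last_uniformly g F b ->
    cvg_last_uniformly (fun x => f x + s * g x) F (a + s * b).
  move=> s1 fa gb e e0; have e2 : 0 < e / 2 by rewrite divr_gt0.
  apply: filterS2 (fa _ e2) (gb _ e2) => t ft gt x xt.
  have -> : f x + s * g x - (a + s * b) = (f x - a) + s * (g x - b).
    by move: (f x) (g x); clear => *; ring.
  rewrite (le_lt_trans (ler_normD _ _))// normrM s1 mul1r [ltRHS]splitr.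
  by rewrite ltrD// ?ft ?gt.
have wE : w = fun x => U x + 1 * V x by apply/funext => x; rewrite mul1r.
have zE : z = fun x => U x + -1 * V x by apply/funext => x; rewrite mulN1r.
have FP : Filter (pinfty_nbhs R) by exact _.
have FN : Filter (ninfty_nbhs R) by exact _.
have n1 : `|1 : R| = 1 by rewrite normr1.
have n2 : `|-1 : R| = 1 by rewrite normrN1.
have w1 : cvg_last_uniformly w +oo 1.
  by have := cvgD _ FP _ _ _ _ _ n1 U_pinfty V_pinfty; rewrite -wE mulr0 addr0.
have w2 : cvg_last_uniformly w -oo 1.
  by have := cvgD _ FN _ _ _ _ _ n1 U_ninfty V_ninfty; rewrite -wE mulr1 add0r.
have z1 : cvg_last_uniformly z +oo 1.
  by have := cvgD _ FP _ _ _ _ _ n2 U_pinfty V_pinfty; rewrite -zE mulr0 addr0.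
have z2 : cvg_last_uniformly z -oo (-1).
  by have := cvgD _ FN _ _ _ _ _ n2 U_ninfty V_ninfty; rewrite -zE mulr1 add0r.
have [alpha Halpha] := allen_cahn_heteroclinic Aw Az w1 w2 z1 z2.
exists alpha => x; have [] := Halpha x; rewrite /w /z.
by move: (tanh _) (U x) (V x); clear => T a b ab <-; split; lra.
Qed.
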